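(* For every real $p\ge 1$, we have $\mathbb{R}^{\mathbb{N}}/\ell_p\le_B\mathbb{R}^{\mathbb{N}}/J\iff p\le 2$.
   Context: $\mathbb{N}=\{0,1,2,\dots\}$. $J$ is James' space: for $a\in\mathbb{R}^{\mathbb{N}}$ put $$\|a\|_J=\tfrac{1}{\sqrt2}\sup\left[(a(n_1)-a(n_2))^2+(a(n_2)-a(n_3))^2+\cdots+(a(n_{m-1})-a(n_m))^2+(a(n_m)-a(n_1))^2\right]^{1/2},$$ the supremum being over all choices of $m$ and $n_1<n_2<\cdots<n_m$; then $J=c_0\cap\{a\in\mathbb{R}^{\mathbb{N}}:\|a\|_J<+\infty\}$, where $c_0$ is the set of real null sequences. For a linear subspace $L\subseteq\mathbb{R}^{\mathbb{N}}$, $\mathbb{R}^{\mathbb{N}}/L$ is the equivalence relation on $\mathbb{R}^{\mathbb{N}}$ in which $a,b$ are equivalent iff $a-b\in L$. For equivalence relations $E,F$ on Polish spaces $Z,W$, $E\le_B F$ means there is a Borel function $\theta:Z\to W$ with $(x,y)\in E\iff(\theta(x),\theta(y))\in F$ for all $x,y\in Z$. *)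

(* Defs.v *)
From HB Require Import structures.
From mathcomp Require Import all_boot all_order all_algebra.
From mathcomp Require Import all_classical all_reals all_analysis.

Set Implicit Arguments.
Unset Strict Implicit.
Unset Printing Implicit Defensive.

Import Order.TTheory GRing.Theory Num.Theory.
Import numFieldNormedType.Exports.

Local Open Scope classical_set_scope.
Local Open Scope ring_scope.

Definition borel_set (Z : topologicalType) : set (set Z) := <<s @open Z >>.

Definition borel_function (Z W : topologicalType) (theta : Z -> W) : Prop :=
  forall B : set W, borel_set B -> borel_set (theta @^-1` B).

Definition borel_reducible (Z W : topologicalType)
    (E : Z -> Z -> Prop) (F : W -> W -> Prop) : Prop :=
  exists theta : Z -> W, borel_function theta /\
    forall x y, E x y <-> F (theta x) (theta y).

(* The topology on real sequences enters through the type of [a] and [b]: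
   [nat -> R] carries no canonical topology; [{ptws nat -> R}] is
   the same type with the product topology. *)
Definition quotient_rel (R : realType) (L : set (nat -> R))
    (a b : {ptws nat -> R}) : Prop := L (a \- b).

Definition ell (R : realType) (p : R) : set (nat -> R) :=
  [set a | (\sum_(0 <= n <oo) (`|a n| `^ p)%:E < +oo)%E].

(* There are [m.+1] indices, and [ordS] is the cyclic successor on ['I_m.+1], so
   the last summand is the wrap-around term [(a (n m) - a (n 0)) ^+ 2]. *)
Definition james_cycle (R : realType) (a : nat -> R) (m : nat)
    (n : 'I_m.+1 -> nat) : R :=
  \sum_(i < m.+1) (a (n i) - a (n (ordS i))) ^+ 2.

Definition james_norm (R : realType) (a : nat -> R) : \bar R :=
  (((Num.sqrt 2)^-1 : R)%:E *
   ereal_sup [set x | exists (m : nat) (n : 'I_m.+1 -> nat),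
     {homo n : i j / (i < j)%N} /\
     x = (Num.sqrt (james_cycle a n))%:E])%E.

Definition james (R : realType) : set (nat -> R) :=
  [set a | a @ \oo --> (0 : R) /\ (james_norm a < +oo)%E].

(* Main.v *)
Require Import Defs.
From mathcomp Require Import all_boot all_order all_algebra.
From mathcomp Require Import all_classical all_reals all_analysis.
From mathcomp Require Import ring lra zify.
Import Order.TTheory GRing.Theory Num.Theory.
Import numFieldNormedType.Exports.
Local Open Scope classical_set_scope.
Local Open Scope ring_scope.

Set Implicit Arguments.
Unset Strict Implicit.
Unset Printing Implicit Defensive.

(** A null sequence belongs to James' space exactly when the sums of squares of
its increments along increasing finite paths are bounded ([jamesP]); the square
roots of these sums are seminorms, and they drive both directions.

For p <= 2, squared differences of well chosen functions of one real variable
imitate |x - y|^p: for p = 2 the identity is enough, and for p < 2 the lacunary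
family of functions 2^(-jp/2) cos (2^j x) and 2^(-jp/2) sin (2^j x), together
with the identity, does it up to constants and up to truncation at 1
([lacunary_chord_le], [lacunary_chord_ge]), because min (4, (2^j d)^2) summed
with weights 2^(-jp) is comparable to d^p when 0 < p < 2.  Listing all these
functions of all coordinates of a at the even places of a sequence, with zeros
at the odd places, gives a continuous reduction: for sequences which vanish at
all odd places, membership in J is square summability
([interleave_reduction]).

For p > 2, let theta be a Borel reduction.  Rounding the n-th coordinate of
theta to a multiple of 2^(-n) changes its values by elements of J only
([rounded_james]), and it makes each coordinate, on a comeager set of rational
sequences, locally constant for the product of the discrete topologies
([rounded_gen_lc]).  Call psi the rounded map.  One may choose the comeager set
G closed under finite modifications, and such that every upper bound 1 / (k + 1)
for the oscillation of psi z - psi w, where z and w in G differ at finitely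
many places, persists when z and w are replaced by nearby points of G with the
same differences ([generic_for_exists]).  There are two cases.

If near every point of G some coordinate can be moved from 0 to 1 at
arbitrarily small cost, where the cost is the oscillation of the change of psi,
then a fusion argument builds x and y in G which differ by 1 at infinitely
many places while the costs of the successive moves are summable; then
psi y - psi x is in J although x - y is not in l_p ([cheap_jumps_absurd]).

Otherwise the cost of moving any far coordinate from 0 to 1 is at least some
d > 0 near some point.  Cutting the move into m equal steps, one of them costs
at least d / m by the triangle inequality.  Choose m_j such that the sum of
m_j^(-p) converges and the sum of m_j^(-2) diverges ([exponent_gap]), which is
where p > 2 is used, and fuse one step of length 1 / m_j for each j.  Since the
changes of psi caused by the different steps can be observed on consecutive
intervals of coordinates, their squares add up: x - y is in l_p, but
psi y - psi x has infinite quadratic variation ([costly_jumps_absurd]). *)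

(** * Sums of nonnegative terms *)

Lemma ler_psum (R : realType) (F : nat -> R) n N : (forall i, 0 <= F i) ->
  (n <= N)%N ->
  \sum_(i < n) F i <= \sum_(i < N) F i.
Proof.
move=> F0 /subnKC <-; elim: (N - n)%N => [|k IH]; first by rewrite addn0.
by rewrite addnS big_ord_recr /= (le_trans IH) // lerDl.
Qed.

Lemma sum_uniq_sub (R : realType) (I : eqType) (f : I -> R) (s t : seq I) :
  (forall i, 0 <= f i) -> uniq t -> uniq s -> {subset s <= t} ->
  \sum_(i <- s) f i <= \sum_(i <- t) f i.
Proof.
move=> f0 ut us st; rewrite [leRHS](bigID (mem s)) /= -[X in _ <= X + _]big_filter.
rewrite [X in _ <= X + _](perm_big s) ?lerDl ?sumr_ge0 //=.
apply: uniq_perm; rewrite ?filter_uniq // => i; rewrite mem_filter.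
by case: (boolP (i \in s)) => // /st ->.
Qed.

Lemma bounded_psum_cvg0 (R : realType) (F : nat -> R) M : (forall i, 0 <= F i) ->
  (forall N, \sum_(n < N) F n <= M) -> F @ \oo --> (0 : R).
Proof.
move=> F0 FM; apply: cvg_series_cvg_0; apply: nondecreasing_is_cvgn.
  by apply/nondecreasing_seqP => n; rewrite !seriesEnat /= big_nat_recr //= lerDl.
by exists M => _ [n _ <-]; rewrite seriesEnat /= big_mkord.
Qed.

(** The truncated terms tend to 0, so the truncation is eventually
inactive. *)
Lemma truncated_psum_bounded (R : realType) (F : nat -> R) M :
  (forall i, 0 <= F i) ->
  (forall N, \sum_(n < N) Num.min 1 (F n) <= M) ->
  exists B, forall N, \sum_(n < N) F n <= B.
Proof.
move=> F0 FM; have m0 i : 0 <= Num.min 1 (F i) by rewrite le_min ler01 F0.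
have /cvgrPdist_lt/(_ 1 ltr01)[L _ LP] := bounded_psum_cvg0 m0 FM.
exists (\sum_(n < L) F n + M) => N.
apply: le_trans (ler_psum F0 (leq_addl L N)) _.
rewrite big_split_ord /=; apply: lerD => //; apply: le_trans (FM (L + N)%N).
rewrite big_split_ord /= -[leLHS]add0r lerD ?sumr_ge0 //; apply: ler_sum => i _.
have := LP (L + i)%N (leq_addr _ _); rewrite /= sub0r normrN ger0_norm //.
by rewrite gt_min ltxx /= => /ltW h; rewrite le_min h lexx.
Qed.

(** * Quadratic variation along increasing paths *)

Fixpoint qvar (R : realType) (a : nat -> R) (x : nat) (s : seq nat) : R :=
  if s is y :: s' then (a x - a y) ^+ 2 + qvar a y s' else 0.

Lemma qvar_ge0 (R : realType) (a : nat -> R) x s : 0 <= qvar a x s.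
Proof. by elim: s x => //= y s IH x; rewrite addr_ge0 ?sqr_ge0. Qed.

Lemma qvar_cat (R : realType) (a : nat -> R) x s t :
  qvar a x (s ++ t) = qvar a x s + qvar a (last x s) t.
Proof. by elim: s x => [|y s IH] x /=; rewrite ?add0r // IH addrA. Qed.

Lemma eq_qvar (R : realType) (a b : nat -> R) x s :
  (forall m, m \in x :: s -> a m = b m) -> qvar a x s = qvar b x s.
Proof.
elim: s x => //= y s IH x ab; rewrite !ab ?inE ?eqxx ?orbT //; congr (_ + _).
by apply: IH => m my; apply: ab; rewrite inE my orbT.
Qed.

Lemma path_leq_last x t i : path leq x t -> i \in x :: t -> (i <= last x t)%N.
Proof.
elim: t x i => [|y t IH] x i /=; first by rewrite inE => _ /eqP ->.
move=> /andP[xy yt]; rewrite inE => /orP[/eqP ->|]; last exact: IH.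
exact: leq_trans xy (IH y y yt (mem_head y t)).
Qed.

Lemma qvar_sum (R : realType) (a : nat -> R) x t :
  qvar a x t =
  \sum_(i < size t) (a (nth 0%N (x :: t) i) - a (nth 0%N (x :: t) i.+1)) ^+ 2.
Proof.
elim: t x => [|y t IH] x /=; first by rewrite big_ord0.
by rewrite big_ord_recl /= IH; congr (_ + _); apply: eq_bigr => i _; rewrite add0n.
Qed.

Lemma qvar_strict (R : realType) (a : nat -> R) x s : path leq x s ->
  exists t, path ltn x t /\ qvar a x t = qvar a x s.
Proof.
elim: s x => [|y s IH] x /=; first by exists [::].
move=> /andP[xy ys]; have [t [yt ts]] := IH y ys.
move: xy; rewrite leq_eqVlt => /orP[/eqP->|xy].
  by exists t; rewrite subrr expr0n add0r.
by exists (y :: t); rewrite /= xy ts.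
Qed.

Lemma minkowski2 (R : realType) (x y u v : R) :
  Num.sqrt ((x + y) ^+ 2 + (u + v) ^+ 2) <=
  Num.sqrt (x ^+ 2 + u ^+ 2) + Num.sqrt (y ^+ 2 + v ^+ 2).
Proof.
have A0 : 0 <= x ^+ 2 + u ^+ 2 by rewrite addr_ge0 ?sqr_ge0.
have B0 : 0 <= y ^+ 2 + v ^+ 2 by rewrite addr_ge0 ?sqr_ge0.
set A := Num.sqrt (x ^+ 2 + _); set B := Num.sqrt (y ^+ 2 + _).
have AB0 : 0 <= A + B by rewrite addr_ge0 ?sqrtr_ge0.
rewrite -[A + B]ger0_norm // -sqrtr_sqr ler_wsqrtr //.
have CS : x * y + u * v <= A * B.
  apply: le_trans (ler_norm _) _; rewrite -sqrtr_sqr -sqrtrM // ler_wsqrtr //.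
  by have := sqr_ge0 (x * v - u * y); rewrite !expr2; nra.
have -> : (A + B) ^+ 2 = x ^+ 2 + u ^+ 2 + (y ^+ 2 + v ^+ 2) + 2 * (A * B).
  by rewrite sqrrD !sqr_sqrtr // -mulr_natl; ring.
by move: CS; rewrite !expr2; nra.
Qed.

(** Minkowski's inequality in Euclidean space, obtained from the plane case
by induction on the path. *)
Lemma sqrt_qvarD (R : realType) (a b : nat -> R) x s :
  Num.sqrt (qvar (a \+ b) x s) <=
  Num.sqrt (qvar a x s) + Num.sqrt (qvar b x s).
Proof.
elim: s x => [|y s IH] x /=; first by rewrite sqrtr0 addr0.
have := minkowski2 (a x - a y) (b x - b y)
  (Num.sqrt (qvar a y s)) (Num.sqrt (qvar b y s)).
rewrite !sqr_sqrtr ?qvar_ge0 //; apply: le_trans; rewrite ler_wsqrtr //.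
apply: lerD; first by rewrite le_eqVlt; apply/orP; left; apply/eqP; ring.
rewrite -[leLHS]sqr_sqrtr ?qvar_ge0 // ler_pXn2r ?nnegrE ?addr_ge0 ?sqrtr_ge0 //.
Qed.

(** Weakly increasing paths are allowed because they are stable under the
maps m |-> max b m; a repeated index contributes nothing. *)
Definition osc_le (R : realType) (l : nat) (a : nat -> R) (M : R) : Prop :=
  forall x s, (l <= x)%N -> path leq x s -> Num.sqrt (qvar a x s) <= M.

Lemma osc_le_ge0 (R : realType) l (a : nat -> R) M : osc_le l a M -> 0 <= M.
Proof.
move=> aM; apply: le_trans (aM l [::] (leqnn l) isT); exact: sqrtr_ge0.
Qed.

Lemma osc_le_weak (R : realType) l (a : nat -> R) M N : M <= N -> osc_le l a M ->
  osc_le l a N.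
Proof. by move=> MN aM x s lx xs; apply: le_trans MN; exact: aM. Qed.

Lemma osc_le_geq (R : realType) l l' (a : nat -> R) M : (l <= l')%N ->
  osc_le l a M -> osc_le l' a M.
Proof. by move=> ll aM x s lx; apply: aM; exact: leq_trans lx. Qed.

Lemma osc_le_self (R : realType) l (a : nat -> R) : osc_le l (a \- a) 0.
Proof.
move=> x s _ _; suff -> : qvar (a \- a) x s = 0 by rewrite sqrtr0.
by elim: s x => //= y s IH x; rewrite IH !subrr expr0n addr0.
Qed.

Lemma osc_leD (R : realType) l (a b : nat -> R) M N :
  osc_le l a M -> osc_le l b N -> osc_le l (a \+ b) (M + N).
Proof.
move=> aM bN x s lx xs; apply: le_trans (sqrt_qvarD _ _ _ _) _.
by apply: lerD; [exact: aM|exact: bN].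
Qed.

Lemma osc_leN (R : realType) l (a : nat -> R) M : osc_le l a M -> osc_le l (\- a) M.
Proof.
move=> aM x s lx xs; have -> : qvar (\- a) x s = qvar a x s.
  elim: s x {lx xs} => //= y s IH x; rewrite IH; congr (_ + _).
  by rewrite -opprD sqrrN.
exact: aM.
Qed.

Lemma osc_le_triangle (R : realType) l (a b c : nat -> R) M N :
  osc_le l (a \- b) M -> osc_le l (b \- c) N -> osc_le l (a \- c) (M + N).
Proof.
move=> ab bc; have -> : a \- c = (a \- b) \+ (b \- c).
  by apply/funext => n /=; rewrite addrA subrK.
exact: osc_leD.
Qed.

Lemma osc_le_chain (R : realType) l (v : nat -> nat -> R) m M :
  (forall q, (q < m)%N -> osc_le l (v q.+1 \- v q) M) ->
    osc_le l (v m \- v 0%N) (m%:R * M).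
Proof.
elim: m => [|m IH] vM; first by rewrite mul0r; exact: osc_le_self.
rewrite -natr1 mulrDl mul1r addrC; apply: osc_le_triangle (vM m _) _ => //.
by apply: IH => q qm; apply: vM; exact: ltnW.
Qed.

Lemma osc_le_sub (R : realType) l (a : nat -> R) M x y : osc_le l a M ->
  (l <= x)%N -> (x <= y)%N -> `|a x - a y| <= M.
Proof.
move=> aM lx xy; have := aM x [:: y] lx; rewrite /= xy addr0 sqrtr_sqr.
by apply.
Qed.

(** Let the second index of an increment go to infinity. *)
Lemma osc_le_norm (R : realType) (a : nat -> R) M n : osc_le 0 a M ->
  a @ \oo --> (0 : R) -> `|a n| <= M.
Proof.
move=> aM a0; apply/ler_addgt0Pr => e e0.
have /cvgrPdist_lt /(_ e e0) [N _ aN] := a0.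
have := aN (maxn n N) (leq_maxr _ _); rewrite /= sub0r normrN => h.
have := osc_le_sub aM (leq0n n) (leq_maxl n N).
have := ler_normD (a n - a (maxn n N)) (a (maxn n N)); rewrite subrK.
by move: h; lra.
Qed.

(** Otherwise paths of quadratic variation at least e^2 exist beyond every
index; concatenating many of them contradicts the bound M. *)
Lemma osc_le_tail (R : realType) (a : nat -> R) M e : osc_le 0 a M -> 0 < e ->
  exists l, osc_le l a e.
Proof.
move=> aM e0; apply: contrapT => Nl.
have step l : exists x s, [/\ (l <= x)%N, path leq x s & e ^+ 2 < qvar a x s].
  apply: contrapT => H; apply: Nl; exists l => x s lx xs.
  rewrite leNgt; apply/negP => ex; apply: H; exists x, s; split => //.
  by rewrite -[ltRHS]sqr_sqrtr ?qvar_ge0 // ltr_pXn2r ?nnegrE ?sqrtr_ge0 ?ltW.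
have many K : exists x s, path leq x s /\ K%:R * e ^+ 2 <= qvar a x s.
  elim: K => [|K [x [s [xs Ks]]]]; first by exists 0%N, [::]; rewrite /= mul0r.
  have [y [t [ly yt et]]] := step (last x s).
  exists x, (s ++ y :: t); split; first by rewrite cat_path xs /= ly yt.
  rewrite qvar_cat /= -natr1 mulrDl mul1r lerD // (le_trans (ltW et)) //.
  by rewrite lerDr sqr_ge0.
have e20 : 0 < e ^+ 2 by rewrite exprn_gt0.
have [x [s [xs]]] := many (Num.truncn (M ^+ 2 / e ^+ 2)).+1.
have M0 := osc_le_ge0 aM.
rewrite leNgt => /negP; apply.
have : qvar a x s <= M ^+ 2.
  rewrite -[leLHS]sqr_sqrtr ?qvar_ge0 // ler_pXn2r ?nnegrE ?sqrtr_ge0 //.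
  exact: aM.
move/le_lt_trans; apply; rewrite -ltr_pdivrMr //.
exact: truncnS_gt.
Qed.

(** If a vanishes up to b, a path can be pushed beyond b without changing its
quadratic variation. *)
Lemma qvar_maxn (R : realType) (a : nat -> R) b x s :
  (forall m, (m <= b)%N -> a m = 0) ->
  qvar a (maxn b x) (map (maxn b) s) = qvar a x s.
Proof.
move=> a0; have aE m : a (maxn b m) = a m.
  by case: (leqP m b) => mb //; rewrite !a0.
by elim: s x => //= y s IH x; rewrite IH !aE.
Qed.

(** * The spaces J and l_p in terms of finite sums *)

Lemma james_cycle_qvar (R : realType) (a : nat -> R) m (n : 'I_m.+1 -> nat) x t :
  size t = m -> (forall i, n i = nth 0%N (x :: t) i) ->
  james_cycle a n = qvar a x t + (a (last x t) - a x) ^+ 2.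
Proof.
move=> tm nE; rewrite /james_cycle big_ord_recr /= qvar_sum tm; congr (_ + _).
  apply: eq_bigr => i _; rewrite !nE /= modn_small ?ltnS //.
rewrite !nE /= modnn /= -{1}tm; congr ((_ - _) ^+ 2).
by rewrite -(last_nth 0%N).
Qed.

(** The wrap-around term of a cycle is the square of a single increment, so a
cycle has at most twice the quadratic variation allowed for paths. *)
Lemma jamesP (R : realType) (a : nat -> R) :
  james a <-> a @ \oo --> (0 : R) /\ exists M, osc_le 0 a M.
Proof.
have c0 : (0 : R) < (Num.sqrt 2)^-1 by rewrite invr_gt0 sqrtr_gt0.
rewrite /james /= /james_norm.
set S := [set x | _]; split=> -[a0 aM]; split=> //.
- have [r rS] : exists r : R, forall y, S y -> (y <= r%:E)%E.
    have ub : forall y, S y -> (y <= ereal_sup S)%E.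
      by move=> y Sy; exact: ereal_sup_ubound.
    case: (ereal_sup S) aM ub => [r| |] aM ub; first by exists r.
      by move: aM; rewrite gt0_muley ?lte_fin // ltxx.
    by exists 0 => y /ub; rewrite leeNy_eq => /eqP ->; rewrite leNye.
  exists r => x s _ /qvar_strict => /(_ R a) [t [xt <-]].
  pose n (i : 'I_(size t).+1) := nth 0%N (x :: t) i.
  have nE i : n i = nth 0%N (x :: t) i by [].
  have Sn : S (Num.sqrt (james_cycle a n))%:E.
    exists (size t), n; split=> // i j ij; rewrite /n.
    by apply: (@sorted_ltn_nth _ ltn ltn_trans) => //; rewrite inE.
  have := rS _ Sn; rewrite lee_fin; apply: le_trans.
  by rewrite ler_wsqrtr // (james_cycle_qvar a (erefl _) nE) lerDl sqr_ge0.
- case: aM => M aM; have M0 := osc_le_ge0 aM.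
  suff : (ereal_sup S <= (Num.sqrt (M ^+ 2 + M ^+ 2))%:E)%E.
    move=> /(lee_wpmul2l (ltW _ : (0%E <= ((Num.sqrt 2)^-1 : R)%:E)%E)) h.
    apply: le_lt_trans (h _) _; first by rewrite lte_fin.
    by rewrite -EFinM ltry.
  apply: ge_ereal_sup => y [m [n [nmono ->]]]; rewrite lee_fin ler_wsqrtr //.
  pose x := n ord0; pose t := mkseq (fun i => n (inord i.+1)) m.
  have nE i : n i = nth 0%N (x :: t) i.
    case: i => -[|i] im /=; first by congr n; apply: val_inj.
    by rewrite nth_mkseq //; congr n; apply: val_inj; rewrite /= inordK.
  rewrite (@james_cycle_qvar _ a m n x t (size_mkseq _ _) nE).
  have xt : path leq x t.
    apply/(pathP 0%N) => i; rewrite size_mkseq => im.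
    have -> : nth 0%N (x :: t) i = n (inord i) by rewrite nE inordK ?ltnS 1?ltnW.
    by rewrite nth_mkseq //; apply: ltnW; apply: nmono;
      rewrite !inordK // ltnS ltnW.
  apply: lerD.
    rewrite -[leLHS]sqr_sqrtr ?qvar_ge0 // ler_pXn2r ?nnegrE ?sqrtr_ge0 //.
    exact: aM.
  have xl : (x <= last x t)%N.
    have /orP[/eqP->//|] : (last x t == x) || (last x t \in t).
      by rewrite -in_cons mem_last.
    exact: (allP (order_path_min leq_trans xt)).
  rewrite -sqrrN opprB -[leLHS]real_normK ?num_real //.
  by rewrite ler_pXn2r ?nnegrE //; exact: osc_le_sub aM _ _.
Qed.

Lemma jamesB (R : realType) (a b : nat -> R) :
  james a -> james b -> james (a \- b).
Proof.
move=> /jamesP[a0 [M aM]] /jamesP[b0 [N bN]]; apply/jamesP; split.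
  by rewrite -[0](subrr 0); exact: cvgB.
by exists (M + N); apply: osc_leD => //; exact: osc_leN.
Qed.

Lemma jamesD (R : realType) (a b : nat -> R) :
  james a -> james b -> james (a \+ b).
Proof.
move=> /jamesP[a0 [M aM]] /jamesP[b0 [N bN]]; apply/jamesP; split.
  by rewrite -[0](addr0 0); exact: cvgD.
by exists (M + N); apply: osc_leD.
Qed.

(** A strict path meets each index at most once, and
(u - v)^2 <= 2 u^2 + 2 v^2. *)
Lemma james_sq_summable (R : realType) (a : nat -> R) M :
  (forall N, \sum_(n < N) a n ^+ 2 <= M) -> james a.
Proof.
move=> aM; apply/jamesP; split.
  have /cvgrPdist_lt a20 := bounded_psum_cvg0 (fun i => sqr_ge0 (a i)) aM.
  apply/cvgrPdist_lt => e e0; have [N _ h] := a20 (e ^+ 2) (exprn_gt0 2 e0).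
  exists N => // n /h; rewrite /= !sub0r !normrN normrX.
  by rewrite ltr_pXn2r ?nnegrE ?(ltW e0).
exists (Num.sqrt (4 * M)) => x s _ /qvar_strict => /(_ R a) [t [xt <-]].
rewrite ler_wsqrtr //.
have step y u : qvar a y u <= 2 * a y ^+ 2 + 4 * \sum_(i <- u) a i ^+ 2.
  elim: u y => [|z u IH] y /=.
    by rewrite big_nil mulr0 addr0 mulr_ge0 ?sqr_ge0.
  rewrite big_cons; have := IH z; have := sqr_ge0 (a y + a z); rewrite !expr2.
  by nra.
have : \sum_(i <- x :: t) a i ^+ 2 <= M.
  apply: le_trans (aM (last x t).+1);
    rewrite -(big_mkord xpredT (fun i => a i ^+ 2)).
  apply: sum_uniq_sub.
  - by move=> i; rewrite sqr_ge0.
  - by rewrite /index_iota iota_uniq.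
  - by apply: (sorted_uniq ltn_trans ltnn).
  - move=> i; rewrite mem_index_iota ltnS => it.
    exact: path_leq_last (sub_path (@ltnW) xt) it.
have := step x t; have := sqr_ge0 (a x); rewrite big_cons.
by lra.
Qed.

(** Completeness of J along a sequence with summable steps.  Oscillations do
not see constants, so the pointwise bound on w - v_j, which gives w -> 0, comes
from the differences v_(j+k) - v_j, which are null sequences. *)
Lemma james_limit (R : realType) (v : nat -> nat -> R) (w : nat -> R) :
  (forall j, james (v j)) -> (forall j, osc_le 0 (v j.+1 \- v j) (2 ^+ j)^-1) ->
  (forall L, exists J, forall j, (J <= j)%N ->
    forall n, (n < L)%N -> v j n = w n) -> james w.
Proof.
move=> vJ vosc vw; apply/jamesP.
have vjk j k :
    osc_le 0 (v (j + k)%N \- v j) (2 * (2 ^+ j)^-1 - 2 * (2 ^+ (j + k))^-1).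
  elim: k => [|k IH].
    by rewrite addn0 subrr; exact: osc_le_self.
  have := osc_le_triangle (vosc (j + k)%N) IH; rewrite addnS; apply: osc_le_weak.
  rewrite [2 ^+ (j + k).+1]exprS invfM mulrA divff // mul1r; lra.
have vj j : osc_le 0 (w \- v j) (2 * (2 ^+ j)^-1).
  move=> x s _ xs; have [J JP] := vw (last x s).+1.
  have E n : (n < (last x s).+1)%N -> v (j + J)%N n = w n.
    by apply: JP; rewrite leq_addl.
  rewrite (_ : qvar _ x s = qvar (v (j + J)%N \- v j) x s).
    apply: le_trans (vjk j J x s (leq0n _) xs) _.
    by rewrite gerBl mulr_ge0 // invr_ge0 exprn_ge0.
  apply: eq_qvar => m ms /=; rewrite E // ltnS.
  exact: path_leq_last xs ms.
have vjn j n : `|w n - v j n| <= 2 * (2 ^+ j)^-1.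
  have [J JP] := vw n.+1.
  have <- : v (j + J)%N n = w n by apply: JP => //; rewrite leq_addl.
  have /jamesP[c0 _] : james (v (j + J)%N \- v j) by exact: jamesB.
  apply: le_trans (osc_le_norm n (vjk j J) c0) _.
  by rewrite gerBl mulr_ge0 // invr_ge0 exprn_ge0.
split; last first.
  have /jamesP[_ [M v0M]] := vJ 0%N.
  have -> : w = (w \- v 0%N) \+ v 0%N by apply/funext => n /=; rewrite subrK.
  by exists (2 * (2 ^+ 0)^-1 + M); exact: osc_leD.
apply/cvgrPdist_lt => e e0.
have [j je] : exists j, 2 * (2 ^+ j)^-1 < e / 2.
  have := @cvg_geometric R 2 2^-1;
    rewrite ger0_norm ?invr_ge0 // invf_lt1 ?ltr1n //.
  move=> /(_ isT)/cvgrPdist_lt/(_ (e / 2));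
    rewrite divr_gt0 // => /(_ isT)[j _ /(_ j (leqnn j))].
  by rewrite /= sub0r normrN ger0_norm ?mulr_ge0 ?exprn_ge0 ?invr_ge0 // exprVn;
    exists j.
have /jamesP[/cvgrPdist_lt/(_ (e / 2))] := vJ j;
  rewrite divr_gt0 // => /(_ isT)[N _ NP] _.
exists N => // n /NP; rewrite /= !sub0r !normrN => vn.
have := vjn j n; have := ler_normD (w n - v j n) (v j n); rewrite subrK.
by move: je vn; lra.
Qed.

Lemma ellP (R : realType) (p : R) (a : nat -> R) :
  ell p a <-> exists M, forall N, \sum_(n < N) `|a n| `^ p <= M.
Proof.
have pos n : (0 <= (`|a n| `^ p)%:E)%E by rewrite lee_fin powR_ge0.
have sumE N : (\sum_(0 <= n < N) (`|a n| `^ p)%:E = (\sum_(n < N) `|a n| `^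
  p)%:E)%E.
  by rewrite big_mkord -sumEFin.
rewrite /ell /=; split.
  have ub N := @nneseries_lim_ge R (fun n => (`|a n| `^ p)%:E) xpredT 0 N
    (fun n _ _ => pos n).
  move: ub; case: (\big[+%E/0%R]_(0 <= _ <oo) _)%E => [r| |] ub //= _.
    by exists r => N; rewrite -lee_fin -sumE; exact: ub.
  by exists 0 => N; have := ub N; rewrite sumE leeNy_eq => /eqP.
case=> M aM; apply: le_lt_trans (ltry M).
apply: lime_le; first by apply: is_cvg_nneseries => n _ _; exact: pos.
by apply: nearW => N; rewrite sumE lee_fin; exact: aM.
Qed.

Lemma ell_finite (R : realType) (p : R) (a : nat -> R) n : p != 0 ->
  (forall m, (n <= m)%N -> a m = 0) -> ell p a.
Proof.
move=> p0 a0; apply/ellP; exists (\sum_(i < n) `|a i| `^ p) => N.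
have F0 i : 0 <= `|a i| `^ p by exact: powR_ge0.
case: (leqP N n) => [|/ltnW /subnKC <-]; first exact: (ler_psum F0).
elim: (N - n)%N => [|k IH]; first by rewrite addn0.
by rewrite addnS big_ord_recr /= a0 ?leq_addr // normr0 powR0 // addr0.
Qed.

(** * The topology of pointwise convergence *)

Lemma continuous_borel (Z W : topologicalType) (f : Z -> W) :
  continuous f -> borel_function f.
Proof.
move=> cf; apply: (@smallest_sub _ _ _ [set B | borel_set (f @^-1` B)]);
  last first.
  by move=> U oU; apply: sub_sigma_algebra; apply: open_comp => // x _; exact: cf.
split.
- by rewrite /= preimage_set0; exact: sigma_algebra0.
- move=> A /= ?; rewrite setTD preimage_setC -setTD; exact: sigma_algebraCD.
- by move=> A ? /=; rewrite preimage_bigcup; exact: sigma_algebra_bigcup.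
Qed.

Lemma ptws_cvgP (R : realType) (F : set_system (nat -> R)) (f : {ptws nat -> R}) :
  Filter F -> F --> f <-> forall n, (fun g => g n) @ F --> f n.
Proof. by move=> FF; exact: (@pointwise_cvgP nat R F f FF). Qed.

Lemma ptws_continuous (R : realType) (f : {ptws nat -> R} -> {ptws nat -> R}) :
  (forall n, continuous (fun a : {ptws nat -> R} => f a n : R)) -> continuous f.
Proof.
move=> cf x.
have FF : Filter (fmap f (nbhs x)).
  exact: (@fmap_filter _ _ f (nbhs x) (nbhs_filter x)).
apply: (proj2 (@ptws_cvgP R (fmap f (nbhs x)) (f x) FF)) => n.
exact: (cf n x).
Qed.

Lemma ptws_coord_continuous (R : realType) (n : nat) :
  continuous (fun a : {ptws nat -> R} => a n : R).
Proof. by move=> a; exact: (@proj_continuous nat (fun _ => R) n a). Qed.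

(** Otherwise there are points outside O which agree with a on longer
and longer initial segments, and they converge to a. *)
Lemma ptws_open_cylinder (R : realType) (O : set {ptws nat -> R})
    (a : {ptws nat -> R}) : open O -> O a ->
  exists n, forall b : {ptws nat -> R}, (forall m, (m < n)%N -> a m = b m) -> O b.
Proof.
move=> oO Oa; apply: contrapT => H.
have {}H n : exists b : {ptws nat -> R},
    (forall m, (m < n)%N -> a m = b m) /\ ~ O b.
  apply: contrapT => H2; apply: H; exists n => b ab.
  by apply: contrapT => Ob; apply: H2; exists b.
have [b bP] := choice H.
have : (b : nat -> {ptws nat -> R}) @ \oo --> a.
  have FF : Filter (fmap b \oo) by exact: (@fmap_filter _ _ b _ eventually_filter).
  apply: (proj2 (@ptws_cvgP R (fmap b \oo) a FF)) => m.
  apply: cvg_near_cst; exists m.+1 => // n /= mn.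
  by have [/(_ m mn)] := bP n.
move/(_ O (open_nbhs_nbhs (conj oO Oa))) => [N _ /(_ N (leqnn N))].
by have [] := bP N.
Qed.

(** * Baire category in a product of discrete spaces *)

Definition agree (A : Type) (n : nat) (z w : nat -> A) : Prop :=
  forall m, (m < n)%N -> z m = w m.

(** The topology is the product of the discrete topologies on the copies of A.
It refines the usual one when A is a set of reals, so Borel sets keep the Baire
property, and it makes Baire category a matter of finite initial segments. *)
Definition dopen (A : Type) (U : set (nat -> A)) : Prop :=
  forall z, U z -> exists n, forall w, agree n z w -> U w.

Definition ddense (A : Type) (U : set (nat -> A)) : Prop :=
  forall z n, exists w, agree n z w /\ U w.

Definition comeager (A : Type) (C : set (nat -> A)) : Prop :=
  exists U : nat -> set (nat -> A),
    (forall k, dopen (U k) /\ ddense (U k)) /\ (forall z, (forall k, U k z) -> C z).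

Definition lc_on (A T : Type) (C : set (nat -> A)) (f : (nat -> A) -> T) : Prop :=
  forall z, C z -> exists n, forall w, C w -> agree n z w -> f z = f w.

(** Local constancy on a comeager set, for the induced topology.  For a
predicate this is the Baire property of the set that it defines; the functional
form lets several values be combined and then compared. *)
Definition gen_lc (A T : Type) (f : (nat -> A) -> T) : Prop :=
  exists C, comeager C /\ lc_on C f.

(** The finite modifications of z; countably many when A is countable. *)
Definition splice (A : Type) (s : seq A) (z : nat -> A) : nat -> A :=
  fun m => nth (z m) s m.

Lemma agree_refl (A : Type) n (z : nat -> A) : agree n z z.
Proof. by []. Qed.

Lemma agree_trans (A : Type) n (z w v : nat -> A) :
  agree n z w -> agree n w v -> agree n z v.
Proof. by move=> zw wv m mn; rewrite zw ?wv. Qed.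

Lemma agree_leq (A : Type) k n (z w : nat -> A) : (k <= n)%N -> agree n z w ->
  agree k z w.
Proof. by move=> kn zw m mk; apply: zw; exact: leq_trans kn. Qed.

Lemma agree_splice (A : Type) n (s : seq A) (z w : nat -> A) :
  agree n z w -> agree n (splice s z) (splice s w).
Proof. by move=> zw m mn; rewrite /splice zw. Qed.

Lemma splice_mkseq (A : Type) n (z w : nat -> A) :
  (forall m, (n <= m)%N -> z m = w m) -> splice (mkseq z n) w = z.
Proof.
move=> zw; apply/funext => m; rewrite /splice; case: (ltnP m n) => mn.
  by rewrite nth_mkseq.
by rewrite nth_default ?size_mkseq // zw.
Qed.

Lemma leq_increasing (f : nat -> nat) j : (forall j, (f j < f j.+1)%N) ->
  (j <= f j)%N.
Proof. by move=> fS; elim: j => // j IH; exact: leq_ltn_trans IH (fS j). Qed.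

Lemma agree_limit (A : Type) (z : nat -> nat -> A) (n : nat -> nat) :
  (forall j, n j < n j.+1)%N -> (forall j, agree (n j) (z j) (z j.+1)) ->
  exists w, forall j, agree (n j) (z j) w.
Proof.
move=> nS zS.
have nle j k : (j <= n (j + k))%N.
  elim: j k => // j IH k; rewrite addSn; apply: leq_ltn_trans (nS _); exact: IH.
have nk j k : (n j <= n (j + k))%N.
  by elim: k => [|k IH]; rewrite ?addn0 // addnS (leq_trans IH) // ltnW.
have zk j k : agree (n j) (z j) (z (j + k)%N).
  elim: k => [|k IH]; first by rewrite addn0.
  rewrite addnS; apply: agree_trans IH _; exact: agree_leq (nk j k) (zS _).
exists (fun m => z m.+1 m) => j m mj.
case: (leqP j m.+1) => jm.
  by have := zk j (m.+1 - j)%N m mj; rewrite subnKC.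
have := zk m.+1 (j - m.+1)%N m; rewrite subnKC; last exact: ltnW.
by move=> -> //; have := nle m.+1 0%N; rewrite addn0.
Qed.

(** Dependent choice, with a step relation that may vary with time. *)
Lemma dependent_iter (S : Type) (P : S -> Prop)
    (Q : nat -> S -> S -> Prop) (s0 : S) :
  P s0 -> (forall j s, P s -> exists t, P t /\ Q j s t) ->
  exists f : nat -> S, [/\ f 0%N = s0, forall j, P (f j)
    & forall j, Q j (f j) (f j.+1)].
Proof.
move=> Ps0 step.
have step' (js : nat * S) : exists t, P js.2 -> P t /\ Q js.1 js.2 t.
  case: (pselect (P js.2)) => [/(step js.1)[t tP]|nP]; first by exists t.
  by exists js.2.
have [F FP] := choice step'.
pose f := fix f j := if j is k.+1 then F (k, f k) else s0.
have Pf j : P (f j) by elim: j => //= j IH; have [] := FP (j, f j) IH.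
by exists f; split=> // j; have [] := FP (j, f j) (Pf j).
Qed.

(** The Baire category theorem, by the usual construction of longer
and longer initial segments. *)
Lemma comeager_nonempty (A : Type) (C : set (nat -> A)) : comeager C -> ddense C.
Proof.
move=> [U [Uod UC]] z n.
have step k (s : (nat -> A) * nat) : True -> exists t : (nat -> A) * nat,
    True /\ [/\ (s.2 < t.2)%N, agree s.2 s.1 t.1 & forall w, agree t.2 t.1 w ->
      U k w].
  move=> _; have [oU dU] := Uod k; have [w [sw Uw]] := dU s.1 s.2.
  have [m Um] := oU _ Uw; exists (w, maxn s.2.+1 m); split=> //; split=> //=.
    by rewrite leq_maxl.
  by move=> v wv; apply: Um; apply: agree_leq wv; rewrite leq_maxr.
have [f [f0 _ fQ]] := dependent_iter (s0 := (z, n)) (P := fun _ => True) I step.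
have [w wP] := @agree_limit A (fun j => (f j).1) (fun j => (f j).2)
  (fun j => let: And3 a _ _ := fQ j in a) (fun j => let: And3 _ b _ := fQ j in b).
exists w; split; first by have := wP 0%N; rewrite f0.
by apply: UC => k; have [_ _] := fQ k; apply; exact: wP.
Qed.

Lemma comeager_sub (A : Type) (C D : set (nat -> A)) : C `<=` D -> comeager C ->
  comeager D.
Proof. by move=> CD [U [Uod UC]]; exists U; split=> // z /UC /CD. Qed.

Lemma comeager_dense_open (A : Type) (U : set (nat -> A)) : dopen U -> ddense U ->
  comeager U.
Proof. by move=> oU dU; exists (fun _ => U); split=> // z /(_ 0%N). Qed.

Lemma comeager_forall (A : Type) (I : countType) (C : I -> set (nat -> A)) :
  (forall i, comeager (C i)) -> comeager (fun z => forall i, C i z).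
Proof.
move=> /choice[U UP].
pose V n := if @unpickle (I * nat)%type n is Some ik then U ik.1 ik.2 else setT.
exists V; split.
  move=> n; rewrite /V; case: unpickle => [[i k]|]; first by have [/(_ k)] := UP i.
  split; first by move=> z _; exists 0%N.
  by move=> z n'; exists z.
move=> z Vz i; have [_] := UP i; apply => k.
by have := Vz (pickle (i, k)); rewrite /V pickleK.
Qed.

Lemma comeagerI (A : Type) (C D : set (nat -> A)) :
  comeager C -> comeager D -> comeager (C `&` D).
Proof.
move=> cC cD; have := @comeager_forall A bool (fun b => if b then C else D).
move=> /(_ _)/comeager_sub; apply; last by case.
by move=> z zCD; split; [exact: (zCD true)|exact: (zCD false)].
Qed.

(** For density, only initial segments at least as long as s matter,
and the entries below [size s] may then be put back as they were in z. *)
Lemma dense_open_splice (A : Type) (s : seq A) (U : set (nat -> A)) :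
  dopen U -> ddense U ->
  dopen (fun z => U (splice s z)) /\ ddense (fun z => U (splice s z)).
Proof.
move=> oU dU; split.
  by move=> z /oU[n nU]; exists n => w zw; apply: nU; exact: agree_splice.
move=> z n; have [w [zw Uw]] := dU (splice s z) (maxn n (size s)).
exists (fun m => if (m < size s)%N then z m else w m); split.
  move=> m mn; case: ltnP => // sm; rewrite -zw; last by rewrite leq_max mn.
  by rewrite /splice nth_default.
suff -> : splice s (fun m => if (m < size s)%N then z m else w m) = w by [].
apply/funext => m; rewrite /splice; case: ltnP => ms; last by rewrite nth_default.
by rewrite -zw // leq_max ms orbT.
Qed.

Lemma comeager_splice (A : Type) (s : seq A) (C : set (nat -> A)) :
  comeager C -> comeager (fun z => C (splice s z)).
Proof.
move=> [U [Uod UC]]; exists (fun k z => U k (splice s z)); split.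
  by move=> k; have [oU dU] := Uod k; exact: dense_open_splice.
by move=> z zU; exact: UC.
Qed.

Lemma lc_on_sub (A T : Type) (C D : set (nat -> A)) (f : (nat -> A) -> T) :
  D `<=` C -> lc_on C f -> lc_on D f.
Proof.
move=> DC fC z /DC/fC[n nP]; exists n => w /DC; exact: nP.
Qed.

Lemma gen_lc_comp (A T S : Type) (f : (nat -> A) -> T) (g : T -> S) :
  gen_lc f -> gen_lc (fun z => g (f z)).
Proof.
move=> [C [cC fC]]; exists C; split=> // z /fC[n nP]; exists n => w Cw zw.
by rewrite (nP w).
Qed.

Lemma gen_lc_comp2 (A T1 T2 S : Type) (f1 : (nat -> A) -> T1)
    (f2 : (nat -> A) -> T2) (g : T1 -> T2 -> S) :
  gen_lc f1 -> gen_lc f2 -> gen_lc (fun z => g (f1 z) (f2 z)).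
Proof.
move=> [C1 [cC1 f1C]] [C2 [cC2 f2C]]; exists (C1 `&` C2).
split; first exact: comeagerI.
move=> z [C1z C2z]; have [n1 n1P] := f1C z C1z; have [n2 n2P] := f2C z C2z.
exists (maxn n1 n2) => w [C1w C2w] zw.
rewrite (n1P w) ?(n2P w) //; apply: agree_leq zw; by rewrite (leq_maxl, leq_maxr).
Qed.

Lemma gen_lc_cst (A T : Type) (t : T) : gen_lc (fun _ : nat -> A => t).
Proof.
exists setT; split; last by move=> z _; exists 0%N.
by exists (fun _ => setT); split=> // k; split=> [z _|z n]; [exists 0%N|exists z].
Qed.

(** Let D be a comeager set on which every P i is locally constant.  Near a
point of D where some P i holds, the union holds on D.  So the points near which
the union holds everywhere on D, or nowhere on D, form a dense open set W, and the
union is locally constant on D `&` W. *)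
Lemma gen_lc_exists (A : Type) (I : countType) (P : I -> (nat -> A) -> Prop) :
  (forall i, gen_lc (P i)) -> gen_lc (fun z => exists i, P i z).
Proof.
move=> /choice[C CP]; pose D z := forall i, C i z.
have cD : comeager D by apply: comeager_forall => i; have [] := CP i.
pose W z := exists n, (forall w, D w -> agree n z w -> exists i, P i w) \/
                      (forall w, D w -> agree n z w -> ~ exists i, P i w).
have oW : dopen W.
  move=> z [n zn]; exists n => w zw; exists n.
  by case: zn => zn; [left|right] => v Dv wv; apply: zn => //;
    exact: agree_trans wv.
have dW : ddense W.
  move=> z n.
  case: (pselect (exists w, [/\ agree n z w, D w & exists i, P i w])).
    move=> [w [zw Dw [i Piw]]]; exists w; split=> //.
    have [_ /(_ w (Dw i))[k kP]] := CP i; exists k; left=> v Dv wv.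
    by exists i; rewrite -(kP v).
  move=> H; exists z; split=> //; exists n; right=> w Dw zw Pw.
  by apply: H; exists w.
exists (D `&` W); split; first by apply: comeagerI => //;
  exact: comeager_dense_open.
move=> z [Dz [n [] zn]]; exists n => w [Dw _] zw; apply: propext; split=> // H.
- by apply: zn.
- by apply: zn.
- by have := zn z Dz (agree_refl _).
- by have := zn w Dw zw.
Qed.

Lemma gen_lc_not (A : Type) (P : (nat -> A) -> Prop) :
  gen_lc P -> gen_lc (fun z => ~ P z).
Proof. exact: (@gen_lc_comp _ _ _ P not). Qed.

Lemma gen_lc_forall (A : Type) (I : countType) (P : I -> (nat -> A) -> Prop) :
  (forall i, gen_lc (P i)) -> gen_lc (fun z => forall i, P i z).
Proof.
move=> Plc.
suff -> : (fun z => forall i, P i z) = (fun z => ~ exists i, ~ P i z).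
  by apply/gen_lc_not/gen_lc_exists => i; exact: gen_lc_not.
by apply/funext => z; rewrite -forallNE; apply: eq_forall => i; rewrite notK.
Qed.

(** The boundary of an open set is nowhere dense. *)
Lemma gen_lc_dopen (A : Type) (U : set (nat -> A)) : dopen U -> gen_lc U.
Proof.
move=> oU; pose W z := exists n, (forall w, agree n z w -> U w) \/
                      (forall w, agree n z w -> ~ U w).
exists W; split.
  apply: comeager_dense_open.
    move=> z [n zn]; exists n => w zw; exists n.
    by case: zn => zn; [left|right] => v wv; apply: zn => //; exact: agree_trans wv.
  move=> z n; case: (pselect (exists w, agree n z w /\ U w)).
    by move=> [w [zw /oU[k kU]]]; exists w; split=> //; exists k; left.
  move=> H; exists z; split=> //; exists n; right=> w zw Uw.
  by apply: H; exists w.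
move=> z [n [] zn]; exists n => w _ zw; apply: propext; split=> // H.
- exact: zn.
- exact: zn.
- by have := zn z (agree_refl _).
- by have := zn w zw.
Qed.

Lemma gen_lc_fibers (A : Type) (T : countType) (f : (nat -> A) -> T) :
  (forall t, gen_lc (fun z => f z = t)) -> gen_lc f.
Proof.
move=> /choice[C CP]; exists (fun z => forall t, C t z); split.
  by apply: comeager_forall => t; have [] := CP t.
move=> z Cz; have [_ /(_ z (Cz _))[n nP]] := CP (f z).
by exists n => w Cw zw; symmetry; rewrite -(nP w).
Qed.

Lemma gen_lc_splice (A T : Type) (s : seq A) (f : (nat -> A) -> T) :
  gen_lc f -> gen_lc (fun z => f (splice s z)).
Proof.
move=> [C [cC fC]]; exists (fun z => C (splice s z)); split.
  exact: comeager_splice.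
move=> z /fC[n nP]; exists n => w Cw zw; apply: nP => //; exact: agree_splice.
Qed.

(** The intersection of the preimages of a comeager set under the countably
many maps [splice s] is comeager, and it is invariant under finite
modifications. *)
Lemma generic_set (A : countType) (I : countType) (T : I -> Type)
    (f : forall i, (nat -> A) -> T i) : (forall i, gen_lc (f i)) ->
  exists U : nat -> set (nat -> A),
    [/\ forall k, dopen (U k),
        ddense (fun z => forall k, U k z),
        forall z w n, (forall m, (n <= m)%N -> w m = z m) ->
          (forall k, U k z) -> forall k, U k w
      & forall i, lc_on (fun z => forall k, U k z) (f i)].
Proof.
move=> /choice[C CP].
have [V [Vod VC]] : comeager (fun z => forall i, C i z).
  by apply: comeager_forall => i; have [] := CP i.
pose U n := if @unpickle (seq A * nat)%type n is Some sk
            then fun z => V sk.2 (splice sk.1 z) else setT.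
have Uod k : dopen (U k) /\ ddense (U k).
  rewrite /U; case: unpickle => [[s k']|].
    by have [oV dV] := Vod k'; exact: dense_open_splice.
  by split=> [z _|z n]; [exists 0%N|exists z].
have UV z : (forall k, U k z) -> forall s k, V k (splice s z).
  by move=> Uz s k; have := Uz (pickle (s, k)); rewrite /U pickleK.
exists U; split.
- by move=> k; have [] := Uod k.
- by apply: comeager_nonempty; exists U.
- move=> z w n wz Uz k; rewrite /U; case: unpickle => //= -[s j] /=.
  have := UV z Uz (mkseq (splice s w) (maxn n (size s))) j.
  rewrite splice_mkseq // => m; rewrite geq_max => /andP[nm sm].
  by rewrite /splice nth_default // wz.
- move=> i; have [_] := CP i; apply: lc_on_sub => z Uz.
  apply: VC => k; have := UV z Uz [::] k; rewrite (_ : splice [::] z = z) //.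
  by apply/funext => m; rewrite /splice nth_nil.
Qed.

(** * Borel maps at generic points *)

Definition ratr_seq (R : realType) (z : nat -> rat) : {ptws nat -> R} :=
  fun n => ratr (z n).

(** The sets B with this property form a sigma-algebra, which contains the
open sets by [ptws_open_cylinder]. *)
Lemma borel_gen_lc (R : realType) (B : set {ptws nat -> R}) :
  borel_set B -> gen_lc (fun z : nat -> rat => B (ratr_seq R z)).
Proof.
move: B; apply: (@smallest_sub _ _ _ [set B | gen_lc (fun z => B (ratr_seq R z))]).
  split.
  - exact: (gen_lc_cst rat False).
  - move=> B /= BP; suff -> :
      (fun z => ([set: {ptws nat -> R}] `\` B) (ratr_seq R z)) =
      (fun z => ~ B (ratr_seq R z)) by exact: gen_lc_not.
    by apply/funext => z; rewrite setTD.
  - move=> F /= FP; suff -> : (fun z => (\bigcup_i F i) (ratr_seq R z)) =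
      (fun z => exists i, F i (ratr_seq R z)) by exact: gen_lc_exists.
    apply/funext => z; apply: propext; split=> [[i _ Fi]|[i Fi]]; by exists i.
move=> O oO /=; apply: gen_lc_dopen => z Oz.
have [n nP] := ptws_open_cylinder oO Oz; exists n => w zw; apply: nP => m mn.
by rewrite /ratr_seq zw.
Qed.

(** The n-th coordinate is rounded down to a multiple of 2^(-n): the values are
discrete, which turns generic continuity into generic local constancy, and the
error is square summable. *)
Definition rounded (R : realType) (a : nat -> R) : nat -> R :=
  fun n => (Num.floor (2 ^+ n * a n))%:~R / 2 ^+ n.

Lemma rounded_james (R : realType) (a : nat -> R) : james (a \- rounded a).
Proof.
apply: (@james_sq_summable _ _ 2) => N.
(* The n-th error is at most 2^(-n), and 4^(-n) <= 2^(-n). *)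
suff : \sum_(n < N) (a \- rounded a) n ^+ 2 <= 2 - 2 * (2 ^+ N)^-1.
  move/le_trans; apply; rewrite gerBl mulr_ge0 // invr_ge0 exprn_ge0 //.
elim: N => [|N IH]; first by rewrite big_ord0 expr0 invr1 mulr1 subrr.
rewrite big_ord_recr /= [2 ^+ N.+1]exprS invfM mulrA divff // mul1r.
suff : (a N - rounded a N) ^+ 2 <= (2 ^+ N)^-1 by move: IH; lra.
have e0 : 0 < 2 ^+ N :> R by rewrite exprn_gt0.
have e1 : 1 <= 2 ^+ N :> R by rewrite exprn_ege1 // ler1n.
have -> : a N - rounded a N =
    (2 ^+ N * a N - (Num.floor (2 ^+ N * a N))%:~R) / 2 ^+ N.
  by rewrite mulrBl mulrAC divff ?mul1r ?gt_eqF.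
set t := _ - _; have t0 : 0 <= t by rewrite subr_ge0 floor_le.
have t1 : t <= 1 by rewrite lerBlDl ltW // -intrD1 floorD1_gt.
have i0 : 0 <= (2 ^+ N)^-1 :> R by rewrite invr_ge0 ltW.
have i1 : (2 ^+ N)^-1 <= 1 :> R by rewrite invf_le1.
rewrite exprMn; apply: le_trans (_ : 1 * (2 ^+ N)^-1 ^+ 2 <= _).
  by rewrite ler_wpM2r ?sqr_ge0 // expr_le1.
by rewrite mul1r expr2 ler_piMr.
Qed.

Lemma rounded_equiv (R : realType) (a b : nat -> R) :
  james (a \- b) <-> james (rounded a \- rounded b).
Proof.
have ra := rounded_james a; have rb := rounded_james b.
split=> J.
  rewrite (_ : _ \- _ = (a \- b) \- ((a \- rounded a) \- (b \- rounded b))).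
    exact: jamesB J (jamesB ra rb).
  by apply/funext => n /=; ring.
rewrite (_ : _ \- _ =
  (rounded a \- rounded b) \+ ((a \- rounded a) \- (b \- rounded b))).
  exact: jamesD J (jamesB ra rb).
by apply/funext => n /=; ring.
Qed.

(** Each fibre of the integer part is the difference of two sets of the
form theta_n < r, which are Borel. *)
Lemma rounded_gen_lc (R : realType) (theta : {ptws nat -> R} -> {ptws nat -> R}) n :
  borel_function theta -> gen_lc (fun z => rounded (theta (ratr_seq R z)) n).
Proof.
move=> bt; apply: (gen_lc_comp (fun k : int => k%:~R / 2 ^+ n)).
apply: gen_lc_fibers => k.
have lcr (r : R) : gen_lc (fun z => 2 ^+ n * theta (ratr_seq R z) n < r : Prop).
  pose O : set {ptws nat -> R} := [set a | 2 ^+ n * a n < r].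
  change (gen_lc (fun z => (theta @^-1` O) (ratr_seq R z))).
  apply: borel_gen_lc; apply: bt; apply: sub_sigma_algebra.
  apply: (@open_comp _ _ (fun a : {ptws nat -> R} => 2 ^+ n * a n : R)
    [set x | x < r]).
    move=> a _; apply: (@continuous_comp _ _ _
      (fun a : {ptws nat -> R} => a n : R) ( *%R (2 ^+ n)) a).
      exact: (@ptws_coord_continuous R n a).
    exact: (@mulrl_continuous R (2 ^+ n) (a n)).
  exact: open_lt.
have := gen_lc_comp2 (fun P Q => P /\ ~ Q) (lcr (k + 1)%:~R) (lcr k%:~R).
suff -> : (fun z => 2 ^+ n * theta (ratr_seq R z) n < (k + 1)%:~R /\
   ~ 2 ^+ n * theta (ratr_seq R z) n < k%:~R) =
   (fun z => Num.floor (2 ^+ n * theta (ratr_seq R z) n) = k) by [].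
apply/funext => z; apply: propext.
split=> [[lt1 /negP]|/eqP]; first by rewrite -leNgt => le1; apply: floor_def;
  rewrite le1.
by rewrite floor_eq => /andP[le1 lt1]; split=> //; apply/negP; rewrite -leNgt.
Qed.

Lemma qvar_gen_lc (R : realType) (A : Type) (f : (nat -> A) -> nat -> R) x s :
  (forall n, gen_lc (fun z => f z n)) -> gen_lc (fun z => qvar (f z) x s).
Proof.
move=> flc; elim: s x => [|y s IH] x /=; first exact: gen_lc_cst.
have := gen_lc_comp2 (fun u v : R => u + v)
  (gen_lc_comp2 (fun u v : R => (u - v) ^+ 2) (flc x) (flc y)) (IH y).
exact.
Qed.

(** The set G, the intersection of the U k, is the set of generic points.  The
last clause makes the cost of a finite modification upper semicontinuous: what
holds at z and w holds at all generic points close to them that differ in the same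
way. *)
Definition generic_for (R : realType) (A : Type) (psi : (nat -> A) -> nat -> R)
    (U : nat -> set (nat -> A)) : Prop :=
  let G z := forall k, U k z in
  [/\ forall k, dopen (U k), ddense G,
      forall z w n, (forall m, (n <= m)%N -> w m = z m) -> G z -> G w,
      forall z L, G z -> exists n, forall w, G w -> agree n z w ->
        agree L (psi z) (psi w)
    & forall l k z w n, G z -> G w -> (forall m, (n <= m)%N -> z m = w m) ->
        osc_le l (psi z \- psi w) k.+1%:R^-1 ->
        exists N, (n <= N)%N /\ forall N', (N <= N')%N ->
          forall z' w', G z' -> G w' -> agree N' z z' -> agree N' w w' ->
          (forall m, (N' <= m)%N -> z' m = w' m) ->
          osc_le l (psi z' \- psi w') k.+1%:R^-1].

(** Once the finite modification s is fixed, the oscillation bound is a predicate of z alone, the conjunction over all paths of conditions on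
finitely many values of psi.  Triples (s, l, k) form a countable set, so all these
predicates are locally constant on one set of generic points. *)
Lemma generic_for_exists (R : realType) (A : countType)
    (psi : (nat -> A) -> nat -> R) :
  (forall n, gen_lc (fun z => psi z n)) -> exists U, generic_for psi U.
Proof.
move=> psilc.
pose I := (nat + (seq A * nat * nat))%type.
pose T (i : I) : Type := if i is inl _ then R else Prop.
pose f (i : I) : (nat -> A) -> T i :=
  match i return (nat -> A) -> T i with
  | inl n => fun z => psi z n
  | inr (s, l, k) => fun z => osc_le l (psi z \- psi (splice s z)) k.+1%:R^-1
  end.
have flc i : gen_lc (f i).
  case: i => [n|[[s l] k]] /=; first exact: psilc.
  have dlc n : gen_lc (fun z => (psi z \- psi (splice s z)) n).
    exact: (gen_lc_comp2 (fun u v : R =>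
      u - v) (psilc n) (gen_lc_splice s (psilc n))).
  apply: gen_lc_forall => x; apply: gen_lc_forall => t.
  have := gen_lc_comp (fun v : R => (l <= x)%N -> path leq x t ->
    Num.sqrt v <= k.+1%:R^-1) (qvar_gen_lc x t dlc).
  exact.
have [U [oU dU mU lU]] := generic_set flc.
exists U; split=> //.
- move=> z L Gz; elim: L => [|L [n nP]]; first by exists 0%N.
  have [n' n'P] := lU (inl L) z Gz.
  exists (maxn n n') => w Gw zw m; rewrite ltnS leq_eqVlt => /orP[/eqP ->|mL].
    by apply: n'P => //; apply: agree_leq zw; rewrite leq_maxr.
  by apply: nP => //; apply: agree_leq zw; rewrite leq_maxl.
- move=> l k z w n Gz Gw zw osc.
  have wE : w = splice (mkseq w n) z by rewrite splice_mkseq // => m nm; rewrite zw.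
  have [n' n'P] := lU (inr (mkseq w n, l, k)) z Gz.
  exists (maxn n n'); split; first by rewrite leq_maxl.
  move=> N' ; rewrite geq_max => /andP[nN' n'N'] z' w' Gz' Gw' zz' ww' zw'.
  have <- : splice (mkseq w n) z' = w'.
    apply/funext => m; rewrite /splice; case: (ltnP m n) => mn.
      by rewrite nth_mkseq // ww' // (leq_trans mn).
    rewrite nth_default ?size_mkseq //; case: (ltnP m N') => mN'; last exact: zw'.
    by rewrite -zz' // zw // ww'.
  have := n'P z' Gz' (agree_leq n'N' zz'); rewrite /= -wE => <-.
  exact: osc.
Qed.

(** Builds two generic points by finite extension.  At stage j the approximations
x and y, which are generic and equal from n on, are changed from n on only; the
task P j n N of the stage must be secured for every pair of generic points with
the same first N values as the new approximations, so that it holds for the two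
limits.  The limits are generic because the initial segment fixed at stage j
forces them into U k for all k <= j. *)
Lemma fusion (A : Type) (U : nat -> set (nat -> A))
    (P : nat -> nat -> nat -> (nat -> A) -> (nat -> A) -> Prop) (z0 : nat -> A) n0 :
  let G z := forall k, U k z in
  (forall k, dopen (U k)) -> G z0 ->
  (forall j x y n, (n0 <= n)%N -> agree n0 z0 y -> G x -> G y ->
    (forall m, (n <= m)%N -> x m = y m) ->
    exists x' y' n', [/\ agree n x x', agree n y y', G x' & G y'] /\
      [/\ forall m, (n' <= m)%N -> x' m = y' m, (n < n')%N &
      forall N, (n' <= N)%N -> forall v w, G v -> G w ->
        agree N x' v -> agree N y' w -> P j n N v w]) ->
  exists x y (N : nat -> nat),
    [/\ G x, G y, N 0%N = n0, forall j, (N j < N j.+1)%N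
      & agree n0 z0 x /\ agree n0 z0 y] /\
    forall j, P j (N j) (N j.+1) x y.
Proof.
move=> G oU Gz0 step.
have dec j z : G z -> exists n, forall w, agree n z w -> forall k, (k <= j)%N ->
  U k w.
  move=> Gz; elim: j => [|j [n nP]].
    have [n nP] := oU _ _ (Gz 0%N); exists n => w zw k; rewrite leqn0 => /eqP ->.
    exact: nP.
  have [n' n'P] := oU _ _ (Gz j.+1).
  exists (maxn n n') => w zw k; rewrite leq_eqVlt => /orP[/eqP ->|kj].
    by apply: n'P => //; apply: agree_leq zw; rewrite leq_maxr.
  by apply: nP => //; apply: agree_leq zw; rewrite leq_maxl.
pose S := ((nat -> A) * (nat -> A) * nat)%type.
pose V (s : S) := [/\ (n0 <= s.2)%N, agree n0 z0 s.1.1, agree n0 z0 s.1.2,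
  G s.1.1 & G s.1.2] /\
  forall m, (s.2 <= m)%N -> s.1.1 m = s.1.2 m.
pose Q (j : nat) (s t : S) := [/\ (s.2 < t.2)%N, agree s.2 s.1.1 t.1.1,
  agree s.2 s.1.2 t.1.2,
  forall v w, agree t.2 t.1.1 v -> agree t.2 t.1.2 w ->
    forall k, (k <= j)%N -> U k v /\ U k w &
  forall v w, G v -> G w -> agree t.2 t.1.1 v -> agree t.2 t.1.2 w ->
    P j s.2 t.2 v w].
have V0 : V (z0, z0, n0) by [].
have stepQ j s : V s -> exists t, V t /\ Q j s t.
  move: s => [[x y] n] [] /= [n0n z0x z0y Gx Gy] xy.
  have [x' [y' [n' [[xx' yy' Gx' Gy'] [xy' nn' nP]]]]] :=
    step j x y n n0n z0y Gx Gy xy.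
  have [a aP] := dec j x' Gx'; have [b bP] := dec j y' Gy'.
  pose N := maxn n' (maxn a b).
  have n'N : (n' <= N)%N by rewrite leq_maxl.
  have aN : (a <= N)%N by rewrite /N maxnCA leq_maxl.
  have bN : (b <= N)%N by rewrite /N maxnA leq_maxr.
  have nN : (n < N)%N by exact: leq_trans n'N.
  exists (x', y', N); split; [split=> /=; first split=> //|split=> //=].
  - by rewrite (leq_trans n0n) // ltnW.
  - exact: agree_trans z0x (agree_leq n0n xx').
  - exact: agree_trans z0y (agree_leq n0n yy').
  - by move=> m Nm; apply: xy'; exact: leq_trans Nm.
  - move=> v w xv yw k kj; split; [apply: aP|apply: bP] => //.
      exact: agree_leq xv.
    exact: agree_leq yw.
  - exact: nP.
have [f [f0 fV fQ]] := dependent_iter V0 stepQ.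
have fN j : ((f j).2 < (f j.+1).2)%N by have [] := fQ j.
have [x xP] := @agree_limit A (fun j => (f j).1.1) _ fN
  (fun j => let: And5 _ a _ _ _ := fQ j in a).
have [y yP] := @agree_limit A (fun j => (f j).1.2) _ fN
  (fun j => let: And5 _ _ a _ _ := fQ j in a).
have Gxy k : U k x /\ U k y by have [_ _ _ + _] := fQ k; apply.
have Gx : G x by move=> k; have [] := Gxy k.
have Gy : G y by move=> k; have [] := Gxy k.
exists x, y, (fun j => (f j).2); split; last first.
  by move=> j; have [_ _ _ _] := fQ j; apply.
split=> //; first by rewrite f0.
by split; [have := xP 0%N|have := yP 0%N]; rewrite f0.
Qed.

(** * The case p > 2 *)

Definition upd (A : Type) (z : nat -> A) i q : nat -> A :=
  fun m => if m == i then q else z m.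

(** Let y_j be y up to N_j and x from there on, so that y_0 = x and each
step from y_j to y_(j+1) is one jump, cheap because y_j is close to the point
where the jump was chosen.  The fusion
makes psi y_(j+1) - psi y_j of oscillation at most 2^(-j), hence
psi y - psi x is in J by [james_limit], although x and y differ by 1 infinitely
often. *)
Lemma cheap_jumps_absurd (R : realType) (p : R) (psi : (nat -> rat) -> nat -> R) U :
  1 <= p -> generic_for psi U ->
  (forall z w, ell p (ratr_seq R z \- ratr_seq R w) <-> james (psi z \- psi w)) ->
  ~ (forall z n k, (forall h, U h z) ->
    exists w i, [/\ forall h, U h w, agree n z w, (n <= i)%N &
       osc_le 0 (psi (upd w i 1) \- psi (upd w i 0)) k.+1%:R^-1]).
Proof.
move=> p1 [oU dU mU cU sU] psiE cheap.
have p0 : p != 0 by rewrite gt_eqF // (lt_le_trans ltr01).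
have [z0 [_ Gz0]] := dU (fun _ => 0) 0%N.
pose P (j n N : nat) (x y : nat -> rat) :=
  (exists i, [/\ (n <= i)%N, (i < N)%N, x i = 0 & y i = 1]) /\
  osc_le 0 (psi (splice (mkseq y N) x) \- psi (splice (mkseq y n) x)) (2 ^+ j)^-1.
have [|x [y [N [[Gx Gy N0 NS _] NP]]]] := @fusion _ U P z0 0 oU Gz0.
  move=> j x y n _ _ Gx Gy xy.
  (* (2 ^ j).-1 encodes the bound 2^(-j). *)
  have [w [i [Gw yw ni wosc]]] := cheap y n (2 ^ j).-1 Gy.
  pose w0 := upd w i 0; pose w1 := upd w i 1.
  have Gw0 : forall h, U h w0.
    apply: (mU w _ i.+1) => // m im; rewrite /w0 /upd; case: eqP im => // ->.
    by rewrite ltnn.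
  have Gw1 : forall h, U h w1.
    apply: (mU w _ i.+1) => // m im; rewrite /w1 /upd; case: eqP im => // ->.
    by rewrite ltnn.
  have w10 m : m != i -> w1 m = w0 m by rewrite /w1 /w0 /upd => /negPf ->.
  have yw1 : agree n y w1.
    move=> m mn; rewrite yw // /w1 /upd; case: eqP => // mi; move: mn.
    by rewrite mi ltnNge ni.
  have [|N1 [iN1 N1P]] := sU 0%N _ w1 w0 i.+1 Gw1 Gw0 _ wosc.
    by move=> m im; apply: w10; rewrite gtn_eqF.
  pose x' m := if (m < n)%N then x m else w0 m.
  have xx' : agree n x x' by move=> m mn; rewrite /x' mn.
  have x'w0 m : (n <= m)%N -> x' m = w0 m by rewrite /x' ltnNge => ->.
  have Gx' : forall h, U h x' by apply: (mU w0 _ n).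
  exists x', w1, N1; split=> //; split.
  - move=> m N1m; rewrite x'w0; last by rewrite (leq_trans _ N1m) // (leq_trans ni)
      // ltnW.
    by rewrite w10 // gtn_eqF // (leq_trans iN1).
  - by rewrite (leq_ltn_trans ni).
  - move=> M N1M v v' Gv Gv' x'v w1v'.
    have iM : (i < M)%N by exact: leq_trans N1M.
    split.
      exists i; split=> //; first by rewrite -x'v // x'w0 // /w0 /upd eqxx.
      by rewrite -w1v' // /w1 /upd eqxx.
    have spl s (z : nat -> rat) m : (size s <= m)%N -> splice s z m = z m.
      by move=> sm; rewrite /splice nth_default.
    have Gs s : forall h, U h (splice s v).
      by apply: (mU v _ (size s)) => // m sm; rewrite spl.
    have h2 : ((2 ^ j).-1.+1%:R : R) = 2 ^+ j by rewrite prednK ?expn_gt0 // natrX.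
    rewrite -h2; apply: (N1P M N1M) => //.
    + by move=> m mM; rewrite /splice nth_mkseq // w1v'.
    + move=> m mM; rewrite /splice; case: (ltnP m n) => mn.
        by rewrite nth_mkseq // -w1v' // w10 // ltn_eqF // (leq_trans mn).
      by rewrite nth_default ?size_mkseq // -x'v // x'w0.
    + by move=> m Mm; rewrite !spl // size_mkseq // (leq_trans ni) // ltnW //
        (leq_trans iM).
have jN j : (j <= N j)%N by exact: leq_increasing.
pose yj j := splice (mkseq y (N j)) x.
have yjx j m : (N j <= m)%N -> yj j m = x m.
  by move=> mN; rewrite /yj /splice nth_default // size_mkseq.
have Gyj j : forall h, U h (yj j) by apply: (mU x _ (N j)) => // m; exact: yjx.
have yjy j : agree (N j) y (yj j).
  by move=> m mN; rewrite /yj /splice nth_mkseq.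
have : james (psi y \- psi x).
  apply: (@james_limit _ (fun j => psi (yj j) \- psi x)).
  - move=> j; apply/psiE; apply: (@ell_finite _ _ _ (N j)) => // m mN /=.
    by rewrite /ratr_seq yjx // subrr.
  - move=> j; rewrite (_ : _ \- _ = psi (yj j.+1) \- psi (yj j)).
      by have [_] := NP j.
    by apply/funext => n /=; ring.
  - move=> L; have [n nP] := cU y L Gy; exists n => j nj m mL /=.
    rewrite -(nP (yj j)) //; apply: agree_leq (yjy j); exact: leq_trans (jN j).
move=> /psiE /ellP[M MP].
have F0 i : 0 <= `|(ratr_seq R y \- ratr_seq R x) i| `^ p by exact: powR_ge0.
have big J : J%:R <= \sum_(i < N J) `|(ratr_seq R y \- ratr_seq R x) i| `^ p.
  elim: J => [|J IH]; first by rewrite sumr_ge0.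
  have [[i [Ni iN xi yi]] _] := NP J.
  apply: le_trans (ler_psum F0 iN); rewrite big_ord_recr /= -natr1.
  apply: lerD; first exact: le_trans IH (ler_psum F0 Ni).
  by rewrite /ratr_seq xi yi rmorph0 rmorph1 subr0 normr1 powR1.
have := le_trans (big (Num.truncn M).+1) (MP _).
by rewrite leNgt truncnS_gt.
Qed.

(** Take m_j = 2^r for the 3 * 4^r indices j with 4^r <= j + 1 < 4^(r+1).
Their contributions are 3 * (4 * 2^(-p))^r, which is summable as p > 2, and 3. *)
Lemma exponent_gap (R : realType) (p : R) : 2 < p -> exists m : nat -> nat,
  [/\ forall j, (0 < m j)%N,
      exists M, forall J, \sum_(j < J) ((m j)%:R^-1 : R) `^ p <= M
    & forall B : R, exists J, B <= \sum_(j < J) ((m j)%:R^-1) ^+ 2].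
Proof.
move=> p2; pose m j := (2 ^ trunc_log 4 j.+1)%N.
have m0 j : (0 < m j)%N by rewrite expn_gt0.
have mE r j : (4 ^ r <= j.+1 < 4 ^ r.+1)%N -> m j = (2 ^ r)%N.
  by move=> h; rewrite /m (@trunc_log_eq 4 r).
pose a r : R := (2 ^ r)%:R^-1.
have block (g : R -> R) r : \sum_(4 ^ r - 1 <= j < 4 ^ r.+1 - 1) g ((m j)%:R^-1) =
    (3 * 4 ^ r)%:R * g (a r).
  rewrite (eq_big_nat _ _ (F2 := fun=> g (a r))); last first.
    move=> j /andP[h1 h2]; rewrite (mE r) //.
    have := expn_gt0 4 r; rewrite expnS in h2 *; lia.
  rewrite sumr_const_nat -[LHS]mulr_natl.
  suff -> : (4 ^ r.+1 - 1 - (4 ^ r - 1) = 3 * 4 ^ r)%N by [].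
  have := expn_gt0 4 r; rewrite expnS; lia.
have sums (g : R -> R) r : \sum_(j < 4 ^ r - 1) g ((m j)%:R^-1) =
    \sum_(i < r) (3 * 4 ^ i)%:R * g (a i).
  elim: r => [|r IH]; first by rewrite !big_ord0.
  rewrite big_ord_recr /= -IH -block -!(big_mkord xpredT (fun j =>
    g ((m j)%:R^-1))).
  rewrite -big_cat_nat //= leq_sub2r // leq_exp2l //.
have rle r : (r <= 4 ^ r - 1)%N.
  have : (r < 4 ^ r)%N by exact: ltn_expl.
  lia.
exists m; split=> //.
- pose q : R := 4 * (2^-1 `^ p).
  have q0 : 0 <= q by rewrite mulr_ge0 ?powR_ge0.
  have q1 : q < 1.
    have i0 : 2^-1 != 0 :> R by rewrite invr_eq0.
    have -> : q = 2^-1 `^ (p - 2).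
      rewrite powRB ?i0 ?implybT // /q mulrC powR_mulrn ?invr_ge0 // exprVn invrK.
      by congr (_ * _); rewrite expr2; ring.
    rewrite -[ltRHS](congr1 (fun f => f (p - 2)) (powR1 R)).
    by rewrite gt0_ltr_powR ?subr_gt0 ?nnegrE ?invr_ge0 ?invf_lt1 ?ltr1n.
  exists (3 / (1 - q)) => J.
  have F0 i : 0 <= ((m i)%:R^-1 : R) `^ p by exact: powR_ge0.
  apply: le_trans (ler_psum F0 (rle J)) _; rewrite (sums (fun x => x `^ p)).
  have term i : (3 * 4 ^ i)%:R * a i `^ p = 3 * q ^+ i.
    rewrite natrM natrX exprMn -mulrA; congr (_ * (_ * _)).
    rewrite /a natrX -exprVn -powR_mulrn ?powR_ge0 ?invr_ge0 // -powR_mulrn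
      ?powR_ge0 //.
    by rewrite -!powRrM mulrC.
  rewrite (eq_bigr (fun i : 'I_J => 3 * q ^+ i)) => [|i _]; last exact: term.
  rewrite -mulr_sumr ler_wpM2l // -[leRHS]mul1r ler_pdivlMr ?subr_gt0 //.
  rewrite mulrC -opprB mulNr -subrX1 opprB gerBl exprn_ge0 //.
- move=> B; exists (4 ^ (Num.truncn B).+1 - 1)%N; rewrite (sums (fun x => x ^+ 2)).
  rewrite (eq_bigr (fun _ => 3)) => [|i _]; last first.
    rewrite /a exprVn natrM -mulrA -!natrX -expnM mulnC expnM divff ?mulr1 //.
  rewrite sumr_const card_ord -[leRHS]mulr_natl.
  apply: le_trans (ltW (truncnS_gt B)) _; rewrite ler_peMr ?ler1n //.
Qed.

(** At stage j, first choose b such that psi y - psi x has tiny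
oscillation beyond b, and freeze a segment which preserves this and decides psi y
up to b.  Beyond the segment, cut the move of one coordinate from 0 to 1 into m_j
equal steps; one of them, d, has oscillation at least a fixed multiple of 1 / m_j.
As d vanishes up to b, this is witnessed by a path beyond b, along which d is the
change of psi y - psi x up to a tiny error.  The witnessing paths of successive
stages can be concatenated. *)
Lemma costly_jumps_absurd (R : realType) (p : R)
    (psi : (nat -> rat) -> nat -> R) U :
  2 < p -> generic_for psi U ->
  (forall z w, ell p (ratr_seq R z \- ratr_seq R w) <-> james (psi z \- psi w)) ->
  ~ (exists z0 n0 k, (forall h, U h z0) /\ forall z i, (forall h, U h z) ->
    agree n0 z0 z ->
      (n0 <= i)%N -> ~ osc_le 0 (psi (upd z i 1) \- psi (upd z i 0)) k.+1%:R^-1).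
Proof.
move=> p2 [oU dU mU cU sU] psiE [z0 [n0 [k [Gz0 costly]]]].
have p0 : p != 0 by rewrite gt_eqF // (lt_trans _ p2).
have [m [m0 [M mM] mdiv]] := exponent_gap p2.
pose d : R := k.+1%:R^-1.
have d0 : 0 < d by rewrite invr_gt0.
pose P (j n N : nat) (x y : nat -> rat) :=
  \sum_(n <= i < N) `|(ratr_seq R x \- ratr_seq R y) i| `^ p <= (m j)%:R^-1 `^ p /\
  exists u S, [/\ (n <= u)%N, path leq u S, (last u S < N)%N &
    (d / 2 * (m j)%:R^-1) ^+ 2 <= qvar (psi y \- psi x) u S].
have [|x [y [N [[Gx Gy N0 NS [zx zy]] NP]]]] := @fusion _ U P z0 n0 oU Gz0.
  move=> j x y n n0n zy Gx Gy xy.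
  have mj0 : 0 < (m j)%:R :> R by rewrite ltr0n.
  (* The tolerance is half of the cost d / m_j of the step to come. *)
  have [b bosc] : exists b, (n <= b)%N /\
      osc_le b (psi y \- psi x) (2 * m j * k.+1).-1.+1%:R^-1.
    have /jamesP[_ [B wB]] : james (psi y \- psi x).
      apply/psiE; apply: (@ell_finite _ _ _ n) => // i ni /=.
      by rewrite /ratr_seq xy // subrr.
    have e0 : 0 < (2 * m j * k.+1).-1.+1%:R^-1 :> R by rewrite invr_gt0 ltr0n.
    have [l lP] := osc_le_tail wB e0.
    by exists (maxn n l); split; [|apply: osc_le_geq lP];
      rewrite ?leq_maxl ?leq_maxr.
  case: bosc => nb bosc.
  have [N1 [nN1 N1P]] := sU _ _ y x n Gy Gx (fun i ni => esym (xy i ni)) bosc.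
  have [N2 N2P] := cU y b.+1 Gy.
  pose i := maxn N1 N2.
  have N1i : (N1 <= i)%N by rewrite leq_maxl.
  have N2i : (N2 <= i)%N by rewrite leq_maxr.
  have ni : (n <= i)%N by exact: leq_trans N1i.
  have Gupd z q : (forall h, U h z) -> forall h, U h (upd z i q).
    move=> Gz; apply: (mU z _ i.+1) => // a ia; rewrite /upd gtn_eqF //.
  have aupd (z : nat -> rat) q : agree i z (upd z i q).
    by move=> a ai; rewrite /upd ltn_eqF.
  pose yq q := upd y i (q%:R / (m j)%:R).
  (* One of the m_j steps is costly, by the triangle inequality. *)
  have [q qm qcost] : exists2 q, (q < m j)%N &
      ~ osc_le 0 (psi (yq q.+1) \- psi (yq q)) (d / (m j)%:R).
    apply: contrapT => H; apply: (costly y i) => //; first exact: leq_trans ni.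
    have -> : k.+1%:R^-1 = (m j)%:R * (d / (m j)%:R) :> R.
      by rewrite mulrCA divff ?mulr1 // gt_eqF.
    have -> : upd y i 1 = yq (m j).
      by rewrite /yq divff // pnatr_eq0 -lt0n.
    have -> : upd y i 0 = yq 0%N by rewrite /yq mul0r.
    apply: (@osc_le_chain _ _ (fun q => psi (yq q))) => q qm.
    by apply: contrapT => Hq; apply: H; exists q.
  pose y' := yq q.+1; pose x' := upd x i (q%:R / (m j)%:R).
  have Gy' : forall h, U h y' by exact: Gupd.
  have Gx' : forall h, U h x' by exact: Gupd.
  (* Both points agree with y up to N2, so psi does not change up to b. *)
  have [u [S [bu uS Scost]]] : exists u S, [/\ (b <= u)%N, path leq u S &
      d / (m j)%:R < Num.sqrt (qvar (psi y' \- psi (yq q)) u S)].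
    apply: contrapT => H; apply: qcost => u S _ uS.
    rewrite leNgt; apply/negP => ltS; apply: H.
    exists (maxn b u), (map (maxn b) S); split.
    - by rewrite leq_maxl.
    - rewrite (homo_path (e := leq)) //; first by move=> c e ce;
        rewrite geq_max !leq_max leqnn ce orbT.
    - rewrite qvar_maxn // => c cb /=.
      rewrite -(N2P y') -?(N2P (yq q)) ?subrr //; try exact: Gupd.
        exact: agree_leq N2i (aupd _ _).
      exact: agree_leq N2i (aupd _ _).
  have osc' : osc_le b (psi (yq q) \- psi x') (2 * m j * k.+1).-1.+1%:R^-1.
    apply: (N1P i N1i); [exact: Gupd|exact: Gupd|exact: aupd|exact: aupd|].
    move=> c ic; rewrite /yq /x' /upd; case: eqP => // _; rewrite xy //.
    exact: leq_trans ic.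
  have cost' : (d / 2 * (m j)%:R^-1) ^+ 2 <= qvar (psi y' \- psi x') u S.
    rewrite -[leRHS]sqr_sqrtr ?qvar_ge0 // ler_pXn2r ?nnegrE ?sqrtr_ge0 //;
      last first.
      by rewrite mulr_ge0 ?invr_ge0 ?divr_ge0 // ltW.
    have := sqrt_qvarD (psi y' \- psi x') (\- (psi (yq q) \- psi x')) u S.
    rewrite (_ : (_ \- _) \+ _ = psi y' \- psi (yq q)); last first.
      by apply/funext => c /=; ring.
    have := osc_leN osc' bu uS.
    have -> : (2 * m j * k.+1).-1.+1%:R^-1 = d / 2 * (m j)%:R^-1 :> R.
      by rewrite prednK ?muln_gt0 ?m0 // !natrM !invfM /d; ring.
    move: Scost; have -> : d / (m j)%:R = d / 2 * (m j)%:R^-1 + d / 2 * (m j)%:R^-1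
      by field; lra.
    by lra.
  have [N3 N3P] := cU x' (last u S).+1 Gx'.
  have [N4 N4P] := cU y' (last u S).+1 Gy'.
  (* The new segment decides psi along the path and contains its last index. *)
  exists x', y', (maxn (maxn N3 N4) (maxn i.+1 (last u S).+1)); split; split=> //.
  - exact: agree_leq ni (aupd _ _).
  - exact: agree_leq ni (aupd _ _).
  - move=> c; rewrite !geq_max => /andP[_ /andP[ic _]].
    rewrite /x' /y' /yq /upd gtn_eqF // xy //; exact: leq_trans (ltnW ic).
  - by rewrite leq_max [X in _ || X]leq_max [(n < i.+1)%N]ltnS ni orbT.
  move=> L; rewrite !geq_max => /andP[/andP[N3L N4L] /andP[iL SL]] v w Gv Gw xv yw.
  split; last first.
    exists u, S; split=> //; first exact: leq_trans bu.
    rewrite (_ : qvar _ u S = qvar (psi y' \- psi x') u S) //.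
    apply: eq_qvar => c /(path_leq_last uS); rewrite -ltnS => cS /=.
    by rewrite (N3P v Gv (agree_leq N3L xv)) // (N4P w Gw (agree_leq N4L yw)).
  have term c : (n <= c < L)%N -> `|(ratr_seq R v \- ratr_seq R w) c| `^ p =
      if c == i then (m j)%:R^-1 `^ p else 0.
    move=> /andP[nc cL]; rewrite /ratr_seq /= -xv // -yw // /x' /y' /yq /upd.
    case: eqP => _; last by rewrite xy // subrr normr0 powR0.
    rewrite -rmorphB -mulrBl -natr1 opprD addrA subrr add0r mulN1r rmorphN normrN.
    by rewrite fmorphV rmorph_nat ger0_norm ?invr_ge0.
  rewrite (eq_big_nat _ _ term) -big_mkcond /=.
  by rewrite big_nat1_eq; case: ifP => // _; exact: powR_ge0.
have jN j : (j <= N j)%N by exact: leq_increasing.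
have F0 i : 0 <= `|(ratr_seq R x \- ratr_seq R y) i| `^ p by exact: powR_ge0.
have xyp : ell p (ratr_seq R x \- ratr_seq R y).
  apply/ellP; exists M => L; apply: le_trans (ler_psum F0 (jN L)) _.
  apply: le_trans (mM L).
  elim: L => [|L IH].
    rewrite N0 big_ord0 big1 // => i _ /=.
    by rewrite /ratr_seq -zx // -zy // subrr normr0 powR0.
  rewrite -(big_mkord xpredT (fun i => `|(ratr_seq R x \- ratr_seq R y) i| `^ p)).
  rewrite (@big_cat_nat _ _ _ (N L)) //=; last exact: ltnW.
  rewrite big_ord_recr /=; apply: lerD; first by rewrite big_mkord.
  by have [] := NP L.
have /jamesP[_ [B wB]] : james (psi y \- psi x).
  have /psiE xyJ := xyp.
  rewrite (_ : psi y \- psi x =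
    (psi x \- psi y) \- ((psi x \- psi y) \+ (psi x \- psi y))).
    by apply: jamesB => //; exact: jamesD.
  by apply/funext => c /=; ring.
have paths J : exists u S, [/\ path leq u S, (last u S <= N J)%N &
    \sum_(j < J) (d / 2 * (m j)%:R^-1) ^+ 2 <= qvar (psi y \- psi x) u S].
  elim: J => [|J [u [S [uS lS IH]]]].
    by exists 0%N, [::]; rewrite big_ord0.
  have [_ [v [T [Nv vT lT cost]]]] := NP J.
  exists u, (S ++ v :: T); split.
  - by rewrite cat_path uS /= vT (leq_trans lS).
  - by rewrite last_cat /= ltnW.
  - rewrite big_ord_recr qvar_cat /= lerD // (le_trans cost) // lerDr sqr_ge0 //.
have [J] := mdiv ((B ^+ 2 + 1) / (d / 2) ^+ 2).
have d2 : 0 < (d / 2) ^+ 2 by rewrite exprn_gt0 // divr_gt0.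
have [u [S [uS _]]] := paths J.
rewrite (eq_bigr (fun j : 'I_J => (d / 2) ^+ 2 * ((m j)%:R^-1) ^+ 2)); last first.
  by move=> j _; rewrite exprMn.
rewrite -mulr_sumr ler_pdivrMr // mulrC => h1 h2.
have := wB u S (leq0n _) uS.
have B0 := osc_le_ge0 wB.
rewrite -(ger0_norm B0) -sqrtr_sqr ler_sqrt ?sqr_ge0 // => h3.
have := le_trans h2 (le_trans h1 h3).
by lra.
Qed.

Lemma ell_not_reducible_james (R : realType) (p : R) : 2 < p ->
  ~ @borel_reducible {ptws nat -> R} {ptws nat -> R}
      (quotient_rel (ell p)) (quotient_rel (@james R)).
Proof.
move=> p2 [theta [btheta thetaE]].
pose psi (z : nat -> rat) := rounded (theta (ratr_seq R z)).
have psiE z w : ell p (ratr_seq R z \- ratr_seq R w) <-> james (psi z \- psi w).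
  exact: (iff_trans (thetaE (ratr_seq R z) (ratr_seq R w)) (rounded_equiv _ _)).
have [U gU] : exists U, generic_for psi U.
  by apply: generic_for_exists => n; exact: rounded_gen_lc.
have p1 : 1 <= p by lra.
apply: (costly_jumps_absurd p2 gU psiE); apply: contrapT => nocost.
apply: (cheap_jumps_absurd p1 gU psiE) => z n k Gz.
apply: contrapT => nocheap; apply: nocost; exists z, n, k;
  split=> // w i Gw zw ni osc.
by apply: nocheap; exists w, i.
Qed.

(** * Coordinatewise reductions *)

Lemma sum_pairs (R : realType) (F : nat -> R) N :
  \sum_(i < N.*2) F i = \sum_(j < N) (F j.*2 + F j.*2.+1).
Proof.
elim: N => [|N IH]; first by rewrite !big_ord0.
by rewrite doubleS !big_ord_recr /= IH addrA.
Qed.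

Lemma sum_even_le_qvar (R : realType) (v : nat -> R) N :
  (forall j, v j.*2.+1 = 0) ->
  \sum_(j < N) v j.*2 ^+ 2 <= qvar v 0 (iota 1 N.*2).
Proof.
move=> v0; elim: N => [|N IH]; first by rewrite big_ord0.
rewrite big_ord_recr doubleS -[N.*2.+2]addn2 iotaD qvar_cat /= add1n.
have -> : last 0%N (iota 1 N.*2) = N.*2.
  by case: (N.*2) => // n; rewrite -[X in iota 1 X]addn1 iotaD last_cat.
by rewrite v0 subr0 lerD // lerDl !addr_ge0 ?sqr_ge0.
Qed.

(** The functions phi k of the coordinates a n, enumerated through a pairing of
nat * nat with nat, are placed at even indices.  The zeros at odd indices make
every even value an increment. *)
Definition interleave (R : realType) (phi : nat -> R -> R)
    (a : nat -> R) : nat -> R :=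
  fun m => if odd m then 0 else
    if pickle_inv m./2 is Some (n, k) then phi k (a n) else 0.

Lemma interleave_odd (R : realType) (phi : nat -> R -> R) a j :
  interleave phi a j.*2.+1 = 0.
Proof. by rewrite /interleave /= odd_double. Qed.

Lemma interleave_even (R : realType) (phi : nat -> R -> R) a j :
  interleave phi a j.*2 =
  if pickle_inv j is Some (n, k) then phi k (a n) else 0.
Proof. by rewrite /interleave odd_double doubleK. Qed.

(** Finitely many codes decode to pairs in some square. *)
Lemma sum_interleave_le (R : realType) (g : nat * nat -> R) N :
  (forall q, 0 <= g q) ->
  exists L, \sum_(j < N) oapp g 0 (pickle_inv j) <=
    \sum_(n < L) \sum_(k < L) g (n : nat, k : nat).
Proof.
move=> g0; pose s := pmap (@pickle_inv (nat * nat)%type) (iota 0 N).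
have [L LP] : exists L, forall q, q \in s -> (q.1 < L)%N && (q.2 < L)%N.
  elim: s => [|q s [L LP]]; first by exists 0%N.
  exists (maxn L (maxn q.1.+1 q.2.+1)) => q';
    rewrite inE => /orP[/eqP ->|/LP/andP[h1 h2]].
    by rewrite !leq_max !leqnn !orbT.
  by rewrite !(leq_trans _ (leq_maxl L _)).
exists L; rewrite -(big_mkord xpredT (fun j => oapp g 0 (pickle_inv j))).
have -> : \sum_(0 <= j < N) oapp g 0 (pickle_inv j) = \sum_(q <- s) g q.
  by rewrite /s big_pmap /index_iota subn0.
pose t := [seq (n, k) | n <- iota 0 L, k <- iota 0 L].
have -> : \sum_(n < L) \sum_(k < L) g (n : nat, k : nat) = \sum_(q <- t) g q.
  rewrite /t big_allpairs -(big_mkord xpredT (fun n => \sum_(k < L) g (n,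
    k : nat))).
  rewrite /index_iota subn0; apply: eq_bigr => n _.
  by rewrite -(big_mkord xpredT (fun k => g (n, k))) /index_iota subn0.
apply: sum_uniq_sub => //.
- by apply: allpairs_uniq; rewrite ?iota_uniq // => -[? ?] [? ?].
- by apply: (pmap_uniq (@pickle_invK _)); exact: iota_uniq.
- move=> [n k] /LP/andP[/= nL kL]; apply/allpairsP; exists (n, k).
  by rewrite !mem_iota.
Qed.

Lemma sum_interleave_ge (R : realType) (g : nat * nat -> R) (K : nat -> nat) N :
  (forall q, 0 <= g q) ->
  exists L, \sum_(n < N) \sum_(k < K n) g (n : nat, k : nat) <=
    \sum_(j < L) oapp g 0 (pickle_inv j).
Proof.
move=> g0; pose t := [seq (n, k) | n <- iota 0 N, k <- iota 0 (K n)].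
pose s := map pickle t.
have [L LP] : exists L, forall j, j \in s -> (j < L)%N.
  elim: s => [|j s [L LP]]; first by exists 0%N.
  exists (maxn L j.+1) => i; rewrite inE => /orP[/eqP ->|/LP h].
    by rewrite leq_max leqnn orbT.
  by rewrite (leq_trans h) // leq_maxl.
exists L; rewrite -(big_mkord xpredT (fun j => oapp g 0 (pickle_inv j))).
have -> : \sum_(n < N) \sum_(k < K n) g (n : nat, k : nat) =
    \sum_(j <- s) oapp g 0 (pickle_inv j).
  rewrite /s big_map (eq_bigr g) => [|q _]; last by rewrite pickleK_inv.
  rewrite /t big_allpairs_dep -(big_mkord xpredT (fun n => \sum_(k < K n) g (n,
    k : nat))).
  rewrite /index_iota subn0; apply: eq_bigr => n _.
  by rewrite -(big_mkord xpredT (fun k => g (n, k))) /index_iota subn0.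
apply: sum_uniq_sub.
- by move=> j; case: pickle_inv => //=.
- by rewrite iota_uniq.
- rewrite map_inj_uniq; last exact: (pcan_inj pickleK).
  apply: allpairs_uniq_dep; first exact: iota_uniq.
    by move=> n _; exact: iota_uniq.
  by move=> [n k] [n' k'] _ _ [-> ->].
- by move=> j /LP jL; rewrite mem_index_iota.
Qed.

(** Let g n k be the square of phi k (a n) - phi k (b n).  If a - b is
in l_p, then the values |a n - b n| are bounded, so that (a n - b n)^2 is at most a
constant times |a n - b n|^p as 1 <= p <= 2, and the sum of all g n k is finite.
Conversely the quadratic variation along 0, 1, 2, ... bounds the sum of all g n k,
hence that of the truncated powers. *)
Lemma interleave_reduction (R : realType) (p c C : R) (phi : nat -> R -> R) :
  1 <= p <= 2 -> 0 < c -> 0 <= C -> (forall k, continuous (phi k)) ->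
  (forall x y K, \sum_(k < K) (phi k x - phi k y) ^+ 2 <=
     C * `|x - y| `^ p + (x - y) ^+ 2) ->
  (forall x y, exists K, c * Num.min 1 (`|x - y| `^ p) <=
     \sum_(k < K) (phi k x - phi k y) ^+ 2) ->
  @borel_reducible {ptws nat -> R} {ptws nat -> R}
    (quotient_rel (ell p)) (quotient_rel (@james R)).
Proof.
move=> /andP[p1 p2] c0 C0 phic up low.
have p0 : p != 0 by rewrite gt_eqF // (lt_le_trans ltr01).
exists (interleave phi : {ptws nat -> R} -> {ptws nat -> R}); split.
  apply: continuous_borel; apply: ptws_continuous => m.
  rewrite /interleave; case: (odd m); first exact: cst_continuous.
  case: pickle_inv => [[n k]|]; last exact: cst_continuous.
  move=> a; apply: (@continuous_comp _ _ _
    (fun a : {ptws nat -> R} => a n : R) (phi k) a).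
    exact: (@ptws_coord_continuous R n a).
  exact: (phic k (a n)).
move=> a b; rewrite /quotient_rel.
set v := interleave phi a \- interleave phi b.
pose g (q : nat * nat) := (phi q.2 (a q.1) - phi q.2 (b q.1)) ^+ 2.
have g0 q : 0 <= g q by exact: sqr_ge0.
have vo j : v j.*2.+1 = 0 by rewrite /v /= !interleave_odd subrr.
have ve j : v j.*2 ^+ 2 = oapp g 0 (pickle_inv j).
  by rewrite /v /= !interleave_even; case: pickle_inv => [[n k]|] //=;
    rewrite subrr expr0n.
have e0 n : 0 <= `|(a \- b) n| `^ p by exact: powR_ge0.
split.
- move=> /ellP[M aM].
  have eM n : `|(a \- b) n| `^ p <= M.
    by apply: le_trans (aM n.+1); rewrite big_ord_recr /= lerDr sumr_ge0.
  have M0 : 0 <= M := le_trans (e0 0%N) (eM 0%N).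
  apply: (@james_sq_summable _ _ ((C + (1 + M)) * M)) => N.
  have N2 : (N <= N.*2)%N by rewrite -addnn leq_addr.
  apply: le_trans (ler_psum (fun i => sqr_ge0 (v i)) N2) _.
  rewrite (sum_pairs (fun i => v i ^+ 2)).
  rewrite (eq_bigr (fun j : 'I_N => oapp g 0 (pickle_inv j))); last first.
    by move=> j _; rewrite vo ve expr0n addr0.
  have [L] := sum_interleave_le N g0; move/le_trans; apply.
  apply: le_trans (ler_wpM2l (_ : 0 <= C + (1 + M)) (aM L));
    last by rewrite !addr_ge0.
  rewrite mulr_sumr; apply: ler_sum => n _.
  apply: le_trans (up (a n) (b n) L) _; rewrite mulrDl lerD //.
  have := eM n; rewrite /=; set d := a n - b n => dM.
  rewrite -real_normK ?num_real //; case: (leP `|d| 1) => d1.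
    apply: le_trans (_ : 1 * `|d| `^ p <= _);
      last by rewrite ler_wpM2r ?powR_ge0 // lerDl.
    rewrite mul1r; case: (eqVneq d 0) => [->|dn0].
      by rewrite normr0 expr0n powR_ge0.
    by rewrite -powR_mulrn // ger_powR // normr_gt0 dn0.
  apply: le_trans (_ : M * `|d| `^ p <= _);
    last by rewrite ler_wpM2r ?powR_ge0 // lerDr.
  have d2 : `|d| <= `|d| `^ p by apply: le1r_powR => //; exact: ltW.
  by rewrite expr2; apply: ler_pM => //; exact: le_trans d2 dM.
- move=> /jamesP[_ [B vB]].
  apply/ellP; apply: (@truncated_psum_bounded _ (fun n =>
    `|(a \- b) n| `^ p) (B ^+ 2 / c) e0) => N.
  have [K KP] := choice (fun n => low (a n) (b n)).
  rewrite ler_pdivlMr // mulr_suml.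
  have [L] := sum_interleave_ge K N g0;
    rewrite (eq_bigr (fun j : 'I_L => v j.*2 ^+ 2)); last first.
    by move=> j _; rewrite ve.
  move=> h; have := le_trans h (sum_even_le_qvar L vo) => {}h.
  apply: le_trans (_ : qvar v 0 (iota 1 L.*2) <= _); last first.
    have B0 := osc_le_ge0 vB.
    rewrite -(@ler_sqrt _ _ (B ^+ 2)) ?sqr_ge0 // sqrtr_sqr ger0_norm //;
      apply: vB => //.
    by rewrite -[path _ _ _]/(sorted leq (iota 0 L.*2.+1)) iota_sorted.
  apply: le_trans h; apply: ler_sum => n _; rewrite mulrC; exact: KP.
Qed.

Lemma ell2_reducible_james (R : realType) :
  @borel_reducible {ptws nat -> R} {ptws nat -> R}
    (quotient_rel (ell 2)) (quotient_rel (@james R)).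
Proof.
apply: (@interleave_reduction R 2 1 0 (fun k x => if k is 0%N then x else 0)) => //.
- by rewrite lexx ler1n.
- by case=> [|k]; [by move=> x|exact: cst_continuous].
- move=> x y [|K]; first by rewrite big_ord0 mul0r add0r sqr_ge0.
  rewrite big_ord_recl /= big1 ?addr0 ?mul0r ?add0r // => i _.
  by rewrite oppr0 expr0n.
- move=> x y; exists 1%N; rewrite big_ord1 mul1r powR_mulrn // real_normK ?num_real
    //.
  by rewrite ge_min lexx orbT.
Qed.

(** * Snowflake embeddings of the line for p < 2 *)

Lemma norm_sin_le (R : realType) (x : R) : `|sin x| <= `|x|.
Proof.
wlog x0 : x / 0 < x => [H|].
  case: (ltgtP x 0) => [x0|/H//|->]; last by rewrite sin0.
  by have := H (- x); rewrite sinN !normrN oppr_gt0; apply.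
have sd (y : R) : y \in `]0, x[ -> is_derive y 1 sin (cos y) by move=> _;
  exact: is_derive_sin.
have [|c _] := MVT x0 sd.
  by apply: continuous_subspaceT => y; exact: continuous_sin.
rewrite sin0 !subr0 => ->; rewrite normrM ler_piMl //.
by rewrite cos_max.
Qed.

(** The squared distance of two points of the unit circle at angle d. *)
Definition chord (R : realType) (d : R) : R := 2 - 2 * cos d.

Lemma chordE (R : realType) (x y : R) :
  (cos x - cos y) ^+ 2 + (sin x - sin y) ^+ 2 = chord (x - y).
Proof.
rewrite /chord cosB; have := cos2Dsin2 x; have := cos2Dsin2 y; rewrite !expr2; nra.
Qed.

Lemma chord_ge0 (R : realType) (d : R) : 0 <= chord d.
Proof. by have := cos_le1 d; rewrite /chord; lra. Qed.

Lemma chord_le4 (R : realType) (d : R) : chord d <= 4.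
Proof. by have := cos_geN1 d; rewrite /chord; lra. Qed.

Lemma chord_le_sqr (R : realType) (d : R) : chord d <= d ^+ 2.
Proof.
have -> : chord d = 4 * sin (d / 2) ^+ 2.
  rewrite /chord {1}(_ : d = (d / 2) *+ 2); last by rewrite mulr2n -splitr.
  by rewrite cos_mulr2n cos2sin2; ring.
have := norm_sin_le (d / 2); rewrite -ler_sqr ?nnegrE // !real_normK ?num_real //.
by rewrite expr_div_n; lra.
Qed.

Lemma chord_norm (R : realType) (d : R) : chord `|d| = chord d.
Proof. by rewrite /chord; case: (ger0P d) => // _; rewrite cosN. Qed.

(** The cosine decreases on the interval from 0 to pi, and 2 <= pi. *)
Lemma chord_ge (R : realType) (d : R) : 1 <= d <= 2 -> chord 1 <= chord d.
Proof.
move=> /andP[d1 d2]; rewrite /chord; suff : cos d <= cos 1 by lra.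
move: d1; rewrite le_eqVlt => /orP[/eqP <- //|d1]; apply: ltW.
have pi2 := pi_ge2 R.
rewrite ltr_cos // in_itv /=; apply/andP; split; lra.
Qed.

Lemma chord1_gt0 (R : realType) : 0 < chord (1 : R).
Proof.
rewrite /chord; suff : cos 1 < cos 0 :> R by rewrite cos0; lra.
have pi2 := pi_ge2 R.
by rewrite ltr_cos // in_itv /=; apply/andP; split; lra.
Qed.

(** Put s = 2^(-p) and let S_K d be the sum.  Then
S_(K+1) d = chord d + s * S_K (2 d), while s * (2 d)^p = d^p.  The induction closes
on [0, 2] for the stronger bound C d^p - A d^2: the gain 4 s A d^2 - A d^2 absorbs
chord d <= d^2, because 4 s > 1 for p < 2. *)
Lemma lacunary_chord_le (R : realType) (p : R) : 1 <= p < 2 ->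
  exists2 C, 0 <= C & forall K d, 0 <= d ->
    \sum_(j < K) (2^-1 `^ p) ^+ j * chord (2 ^+ j * d) <= C * d `^ p.
Proof.
move=> /andP[p1 p2]; set s := 2^-1 `^ p.
have p0 : p != 0 by lra.
have h0 : 0 < 2^-1 :> R by rewrite invr_gt0.
have s0 : 0 < s by exact: powR_gt0.
have s1 : s < 1.
  apply: le_lt_trans (ger_powR _ p1) _; first by rewrite h0 invf_le1 // ler1n.
  by rewrite powRr1 ?ltW // invf_lt1 // ltr1n.
have s4 : 1 < 4 * s.
  have i0 : 2^-1 != 0 :> R by rewrite invr_eq0.
  have -> : s = 4^-1 / 2^-1 `^ (2 - p).
    rewrite -powRN opprB powRB ?i0 ?implybT // powR_mulrn ?ltW // exprVn -/s.
    by rewrite invrK; field.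
  rewrite mulrA divff // mul1r invf_gt1 ?powR_gt0 //.
  have := @gt0_ltr_powR R (2 - p); rewrite subr_gt0 => /(_ p2 2^-1 1).
  by rewrite powR1; apply; rewrite ?nnegrE ?invr_ge0 ?invf_lt1 ?ltr1n.
have s2p d : 0 <= d -> s * (2 * d) `^ p = d `^ p.
  move=> d0; rewrite /s -powRM; [|exact: ltW|exact: mulr_ge0].
  by congr (_ `^ _); field.
pose A := (4 * s - 1)^-1; pose B := 4 / (1 - s); pose C := B + 4 * A.
have A0 : 0 < A by rewrite invr_gt0 subr_gt0.
have B0 : 0 < B by rewrite divr_gt0 // subr_gt0.
have A1 : A * (4 * s - 1) = 1 by rewrite mulVf // gt_eqF // subr_gt0.
have GS K d : \sum_(j < K.+1) s ^+ j * chord (2 ^+ j * d) =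
    chord d + s * \sum_(j < K) s ^+ j * chord (2 ^+ j * (2 * d)).
  rewrite big_ord_recl !expr0 !mul1r mulr_sumr; congr (_ + _).
  by apply: eq_bigr => j _; rewrite /= !exprS mulrA mulrA [_ * 2]mulrC.
(* The bound by a geometric series, used where d^p is at least 1. *)
have GB K d : \sum_(j < K) s ^+ j * chord (2 ^+ j * d) <= B.
  elim: K d => [|K IH] d; first by rewrite big_ord0 ltW.
  rewrite GS; have := chord_le4 d; have := IH (2 * d).
  have : B * (1 - s) = 4 by rewrite mulfVK // gt_eqF // subr_gt0.
  nra.
have big d : 1 <= d -> 1 <= d `^ p.
  by move=> d1; rewrite (le_trans d1) // le1r_powR.
have far d q : 1 < d -> d <= 2 -> 1 <= q -> B <= C * q - A * d ^+ 2.
  move=> d1 d2 q1; have : A * d ^+ 2 <= A * 4.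
    by rewrite ler_pM2l // expr2; nra.
  have : C * 1 <= C * q by rewrite ler_wpM2l // /C; lra.
  by rewrite /C; lra.
have main K d : 0 <= d <= 2 ->
    \sum_(j < K) s ^+ j * chord (2 ^+ j * d) <= C * d `^ p - A * d ^+ 2.
  elim: K d => [|K IH] d /andP[d0 d2]; case: (leP d 1) => d1.
  - rewrite big_ord0 subr_ge0.
    case: (eqVneq d 0) => [->|dn0]; first by rewrite powR0 // expr0n !mulr0.
    apply: ler_pM; rewrite ?sqr_ge0 ?(ltW A0) // /C; first by lra.
    rewrite -powR_mulrn //; apply: ger_powR; last exact: ltW.
    by rewrite d1 lt_neqAle eq_sym dn0 d0.
  - by rewrite big_ord0 (le_trans (ltW B0)) // far // big // ltW.
  - rewrite GS; have := chord_le_sqr d.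
    have /IH : 0 <= 2 * d <= 2 by apply/andP; split; lra.
    move=> /(ler_wpM2l (ltW s0)); rewrite mulrBr mulrCA s2p //.
    rewrite exprMn !expr2; nra.
  - by rewrite (le_trans (GB K.+1 d)) // far // big // ltW.
exists C; first by rewrite /C; nra.
move=> K d d0; case: (leP d 2) => d2.
  have /main : 0 <= d <= 2 by rewrite d0.
  move=> /(_ K)/le_trans; apply; by rewrite gerBl mulr_ge0 ?sqr_ge0 ?(ltW A0).
apply: le_trans (GB K d) _; have : 1 <= d `^ p by apply: big; lra.
by rewrite /C; nra.
Qed.

(** Choose the least j with 1 <= 2^j d; then 2^j d <= 2, so the chord at
this scale is at least a constant, and 2^(-j) >= d / 2. *)
Lemma lacunary_chord_ge (R : realType) (p d : R) : 1 <= p -> 0 < d -> d < 1 ->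
  exists j, 2^-1 `^ p * chord 1 * d `^ p <= (2^-1 `^ p) ^+ j * chord (2 ^+ j * d).
Proof.
move=> p1 d0 d1.
have ex : exists j, 1 <= 2 ^+ j * d.
  exists (Num.truncn d^-1).+1; rewrite -ler_pdivrMr // mul1r.
  apply: le_trans (ltW (truncnS_gt _)) _; rewrite -natrX ler_nat ltnW //.
  exact: ltn_expl.
have [j j1 jmin] := ex_minnP ex; exists j.
have jd2 : 2 ^+ j * d <= 2.
  case: j j1 jmin => [|j] j1 jmin; first by rewrite expr0 mul1r; lra.
  have : 2 ^+ j * d < 1 by rewrite ltNge; apply/negP => /jmin; rewrite ltnn.
  by rewrite exprS -mulrA; lra.
have h0 : 0 <= 2^-1 :> R by rewrite invr_ge0.
rewrite mulrAC; apply: ler_pM.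
- by rewrite mulr_ge0 ?powR_ge0.
- exact: chord_ge0.
- have -> : (2^-1 `^ p) ^+ j = (2^-1 ^+ j) `^ p :> R.
    by rewrite -!powR_mulrn ?powR_ge0 // -!powRrM mulrC.
  rewrite -powRM //; last exact: ltW.
  apply: ge0_ler_powR; rewrite ?nnegrE ?mulr_ge0 ?exprn_ge0 ?(ltW d0) //; first lra.
  by rewrite exprVn -[leRHS]mul1r ler_pdivlMr ?exprn_gt0 //; lra.
- by apply: chord_ge; rewrite j1.
Qed.

(** The identity, then for each j the two coordinates of the point of the circle
of radius 2^(-jp/2) at angle 2^j x; the identity handles distances above 1. *)
Definition wave (R : realType) (p : R) (k : nat) (x : R) : R :=
  if k is k'.+1 then (2^-1 `^ (p / 2)) ^+ k'./2 *
    (if odd k' then sin (2 ^+ k'./2 * x) else cos (2 ^+ k'./2 * x)) else x.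

Lemma sum_wave (R : realType) (p : R) K (x y : R) :
  \sum_(k < K.*2.+1) (wave p k x - wave p k y) ^+ 2 =
  (x - y) ^+ 2 + \sum_(j < K) (2^-1 `^ p) ^+ j * chord (2 ^+ j * `|x - y|).
Proof.
rewrite big_ord_recl /=; congr (_ + _).
rewrite (sum_pairs (fun k => (wave p k.+1 x - wave p k.+1 y) ^+ 2)).
apply: eq_bigr => j _; rewrite /wave /= !odd_double /= uphalf_double doubleK.
rewrite -!mulrBr !exprMn -mulrDr chordE -mulrBr; congr (_ * _).
  have -> : 2^-1 `^ p = (2^-1 `^ (p / 2)) ^+ 2 :> R.
    by rewrite -powR_mulrn ?powR_ge0 // -powRrM divfK.
  by rewrite exprAC.
by rewrite -[in RHS]chord_norm normrM normr_id -normrM chord_norm.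
Qed.

Lemma ell_lt2_reducible_james (R : realType) (p : R) : 1 <= p < 2 ->
  @borel_reducible {ptws nat -> R} {ptws nat -> R}
    (quotient_rel (ell p)) (quotient_rel (@james R)).
Proof.
move=> p12; have /andP[p1 p2] := p12; have [C C0 CP] := lacunary_chord_le p12.
have p0 : p != 0 by lra.
have s0 : 0 < 2^-1 `^ p :> R by rewrite powR_gt0 ?invr_gt0.
have c1 := chord1_gt0 R.
apply: (@interleave_reduction R p (Num.min 1 (2^-1 `^ p * chord 1)) C (wave p)) =>
  //.
- by rewrite p1 ltW.
- by rewrite lt_min ltr01 mulr_gt0.
- case=> [|k]; first by move=> x.
  have trig (f : R -> R) (u : R) : continuous f -> continuous (fun x => f (u * x)).
    move=> fc x; apply: (@continuous_comp R R R ( *%R u) f x); last exact: fc.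
    exact: mulrl_continuous.
  pose f x := if odd k then sin (2 ^+ k./2 * x) else cos (2 ^+ k./2 * x) : R.
  have fc : continuous f.
    rewrite /f; case: (odd k); apply: trig; first exact: continuous_sin.
    exact: continuous_cos.
  move=> x; change ({for x, continuous (( *%R ((2^-1 `^ (p / 2)) ^+ k./2)) \o f)}).
  apply: continuous_comp; first exact: fc.
  exact: mulrl_continuous.
- move=> x y K.
  have KK : (K <= K.*2.+1)%N by rewrite ltnW // ltnS -addnn leq_addr.
  apply: le_trans (ler_psum (F := fun k => (wave p k x - wave p k y) ^+ 2) _ KK) _.
    by move=> i; exact: sqr_ge0.
  by rewrite sum_wave [leRHS]addrC; apply: lerD => //; exact: CP.
- move=> x y; set d := `|x - y|.
  have d0 : 0 <= d by exact: normr_ge0.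
  case: (leP 1 d) => d1.
    exists 1%N; rewrite big_ord1 /=; apply: le_trans (_ : 1 <= _).
      rewrite -[leRHS]mulr1; apply: ler_pM;
        rewrite ?le_min ?ler01 ?powR_ge0 ?ge_min ?lexx //.
      by rewrite mulr_ge0 ?ltW.
    by rewrite -real_normK ?num_real // expr_ge1.
  case: (eqVneq d 0) => [->|dn0].
    by exists 0%N; rewrite big_ord0 powR0 // [Num.min 1 0]min_r ?ler01 // mulr0.
  have dp : 0 < d by rewrite lt_neqAle eq_sym dn0.
  have [j jP] := lacunary_chord_ge p1 dp d1.
  exists j.+1.*2.+1; rewrite sum_wave big_ord_recr /= -/d.
  apply: le_trans (_ : 2^-1 `^ p * chord 1 * d `^ p <= _).
    apply: ler_pM; rewrite ?le_min ?ler01 ?powR_ge0 ?ge_min ?lexx ?orbT //.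
    by rewrite mulr_ge0 ?ltW.
  apply: le_trans jP _; rewrite addrA lerDr addr_ge0 ?sqr_ge0 //.
  apply: sumr_ge0 => i _; rewrite mulr_ge0 ?chord_ge0 ?exprn_ge0 ?powR_ge0 //.
Qed.

Theorem theorem6p3 (R : realType) (p : R) (hp : 1 <= p) :
  @borel_reducible {ptws nat -> R} {ptws nat -> R}
    (quotient_rel (ell p)) (quotient_rel (@james R)) <-> p <= 2.
Proof.
split=> [red|]; last first.
  rewrite le_eqVlt => /orP[/eqP ->|p2]; first exact: ell2_reducible_james.
  by apply: ell_lt2_reducible_james; rewrite hp.
by rewrite leNgt; apply/negP => p2; exact: ell_not_reducible_james p2 red.
Qed.
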